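(* Let $\varphi:T^n\times\mathbb R\to\mathbb R$ be Lipschitz continuous in both variables, with $\varphi(x,y+1)=\varphi(x,y)$ for all $(x,y)$ and $\int_{T^n\times[0,1)}\varphi(x,y)\,dx\,dy=0$. Then there exists $F^*\ge 0$ such that the stationary equation $$0=-(-\Delta)^{1/2}g(x)+\varphi(x,g(x))+F,\qquad x\in T^n,$$ admits a solution $g$ for all $0\le F\le F^*$, while it has no solution for $F>F^*$.
   Context: $T^n$ is the $n$-dimensional flat torus, taken with side length $2\pi$, so that periodic functions have Fourier series indexed by $k\in\mathbb Z^n$, and $(-\Delta)^{1/2}$ is the Fourier multiplier $\widehat{(-\Delta)^{1/2}g}(k)=|k|\,\hat g(k)$. The external force $F$ is a constant, $F\ge0$. A (classical) solution of the stationary equation is a function $g\in C(T^n)$ with $(-\Delta)^{1/2}g\in C(T^n)$ satisfying the equation at every $x\in T^n$. (In the paper, weak $H^{1/2}$ solutions are shown to be the same as classical solutions.) *)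

(* Defs.v *)
From HB Require Import structures.
From mathcomp Require Import all_boot all_order all_algebra.
From mathcomp Require Import complex.
From mathcomp Require Import all_classical all_reals all_analysis.

Set Implicit Arguments.
Unset Strict Implicit.
Unset Printing Implicit Defensive.

Import Order.TTheory GRing.Theory Num.Theory.
Import numFieldNormedType.Exports.

Local Open Scope classical_set_scope.
Local Open Scope ring_scope.

(* Functions on T^n = R^n / (2 pi Z)^n are represented by their lifts to R^n,
   i.e. functions on row vectors that are 2 pi-periodic in each coordinate.
   Continuity on T^n is continuity of the lift, and Lipschitz continuity for
   the flat metric of T^n is Lipschitz continuity of the lift. *)
Definition torus_periodic (R : realType) (n : nat) (V : Type)
    (g : 'rV[R]_n -> V) : Prop :=
  forall (i : 'I_n) (x : 'rV[R]_n), g (x + (2 * pi) *: delta_mx 0 i) = g x.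

(* Integral over the fundamental domain [0, 2 pi]^n, as an iterated Lebesgue
   integral. It is only applied to continuous functions, for which it is the
   n-dimensional Lebesgue integral by Fubini's theorem. *)
Fixpoint torus_int (R : realType) (n : nat) : ('rV[R]_n -> R) -> R :=
  match n return ('rV[R]_n -> R) -> R with
  | 0 => fun f => f 0
  | m.+1 => fun f =>
      \int[@lebesgue_measure R]_(t in `[0, 2 * pi])
        torus_int (fun x : 'rV[R]_m => f (row_mx (t%:M : 'rV[R]_1) x))
  end.

Definition freq_dot (R : realType) (n : nat) (k : 'rV[int]_n) (x : 'rV[R]_n)
    : R :=
  \sum_(i < n) (k 0 i)%:~R * x 0 i.

(* Euclidean length; the library norm on row vectors is the sup norm. *)
Definition freq_norm (R : realType) (n : nat) (k : 'rV[int]_n) : R :=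
  Num.sqrt (\sum_(i < n) ((k 0 i)%:~R : R) ^+ 2).

(* (2 pi)^(-n) times the integral of g(x) exp(-i k.x) over T^n, with the real
   and imaginary parts written out. *)
Definition fourier_coef (R : realType) (n : nat) (g : 'rV[R]_n -> R)
    (k : 'rV[int]_n) : R[i] :=
  Complex
    ((2 * pi) ^- n * torus_int (fun x => g x * cos (freq_dot k x)))
    (- ((2 * pi) ^- n * torus_int (fun x => g x * sin (freq_dot k x)))).

(* h = (-Delta)^(1/2) g. For continuous periodic g and h this determines h,
   since the Fourier coefficients of a continuous function determine it. *)
Definition is_half_laplacian (R : realType) (n : nat) (g h : 'rV[R]_n -> R)
    : Prop :=
  forall k : 'rV[int]_n,
    fourier_coef h k = real_complex R (freq_norm R k) * fourier_coef g k.

Definition torus_continuous (R : realType) (n : nat) (g : 'rV[R]_n -> R)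
    : Prop :=
  torus_periodic g /\ continuous g.

Definition stationary_solution (R : realType) (n : nat)
    (phi : 'rV[R]_n -> R -> R) (F : R) (g : 'rV[R]_n -> R) : Prop :=
  torus_continuous g /\
  exists h : 'rV[R]_n -> R,
    [/\ torus_continuous h,
        is_half_laplacian g h
      & forall x, 0 = - h x + phi x (g x) + F].

(* Main.v *)
(* Put A = (-Delta)^(1/2).  Everything rests on three facts about pairs (g, h)
   of continuous functions with h = A g.

   Minimum principle: A g <= 0 where g attains its minimum.  By Fejer means it is
   enough to treat trigonometric polynomials.  There the average of the
   translates by +-2 eta e_s and the identity is a positive operator with symbol
   z = (1/n) sum_s cos^2 (eta k_s) in [0, 1]; iterating y := (z + y^2) / 2 from 0
   stays within positive operators and converges to 1 - sqrt (1 - z), and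
   sqrt n / eta * sqrt (1 - z) tends to |k| as eta -> 0.  Hence the resolvents of
   A are positive contractions.

   Compactness: (1 + e A)^-(2n+1) has a summable symbol and, by contractivity,
   moves g by at most (2n+1) e |A g|.  So bounds on |A g| and on the Fourier
   coefficients of g control |g| and the modulus of continuity of g, and limits
   of approximate solutions are solutions.

   Implicit steps: A u' + L u' = phi(u) + F + L u, with L > Lip phi.  For F = 0
   they decrease E(u) = <A u, u> / 2 - mean of Phi(x, u), Phi being a primitive
   of phi in y, by at least |u' - u|^2 in L^2.  The mean-zero condition on phi
   makes E invariant under u -> u + 1, hence bounded below on a suitable class;
   one step from a near-minimizer therefore barely moves it and yields an
   approximate solution, so F = 0 is admissible.  Given solutions for
   F0 <= F <= F1, shifted by an integer so as to be ordered, the same step from a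
   subsolution for F in between, of nearly maximal mean, yields an approximate
   solution for F.  The set of admissible F >= 0 is thus an interval; it is closed
   by compactness and bounded since A g has mean zero. *)

Require Import Defs.
From mathcomp Require Import all_boot all_order all_algebra complex.
From mathcomp Require Import all_classical all_reals all_analysis.
From mathcomp Require Import ring lra.
Set Implicit Arguments.
Unset Strict Implicit.
Unset Printing Implicit Defensive.

Import Order.TTheory GRing.Theory Num.Theory.
Import numFieldNormedType.Exports.

Local Open Scope classical_set_scope.
Local Open Scope ring_scope.

(** * Periodic functions on R^n, controlled through the compact fundamental box *)

Section Periodic.
Context {R : realType} {n : nat}.
Implicit Types (f g : 'rV[R]_n -> R) (x y : 'rV[R]_n).

Lemma ler_rV_norm (m : nat) (x : 'rV[R]_m) (c : R) :
  0 <= c -> (forall i, `|x 0 i| <= c) -> `|x| <= c.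
Proof.
move=> c0 xc; rewrite [leLHS]/Num.Def.normr /= mx_normrE; apply/bigmax_leP; split=> //.
by move=> [i j] _ /=; rewrite ord1.
Qed.

Lemma rV_coord_le (m : nat) (x : 'rV[R]_m) (i : 'I_m) : `|x 0 i| <= `|x|.
Proof.
rewrite [leRHS]/Num.Def.normr /= mx_normrE; apply/bigmax_geP; right => /=.
by exists (0, i).
Qed.

Lemma continuous_epsP f : continuous f <->
  forall x (e : R), 0 < e ->
    exists2 d, 0 < d & forall y, `|x - y| < d -> `|f x - f y| <= e.
Proof.
have FF x : Filter (nbhs x) := nbhs_filter x.
split=> [cf x e e0|H x].
  have /cvgrPdist_le/(_ _ e0)/nbhs_ballP[d /= d0 H] := cf x.
  by exists d => // y xy; apply: H; rewrite -ball_normE /=.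
apply/(@cvgrPdist_le _ _ _ (nbhs x) (FF x)) => e e0.
have [d d0 Hd] := H x e e0.
apply/nbhs_ballP; exists d => //= y; rewrite -ball_normE /=; exact: Hd.
Qed.

Lemma periodic_shift f : torus_periodic f ->
  forall (z : 'rV[int]_n) x, f (x + (2 * pi) *: map_mx intr z) = f x.
Proof.
move=> fp z x.
have fint (i : 'I_n) (m : int) w : f (w + ((2 * pi) * m%:~R) *: delta_mx 0 i) = f w.
  have fnat (p : nat) v : f (v + ((2 * pi) * p%:R) *: delta_mx 0 i) = f v.
    elim: p v => [|p IH] v; first by rewrite mulr0 scale0r addr0.
    by rewrite -[p.+1]addn1 natrD mulrDr scalerDl addrA mulr1 fp IH.
  case: m => p; first exact: fnat.
  rewrite NegzE -(fnat p.+1) -addrA -scalerDl -mulrDr.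
  by rewrite mulrNz addNr mulr0 scale0r addr0.
have -> : (2 * pi) *: map_mx intr z =
    \sum_(i < n) ((2 * pi) * (z 0 i)%:~R) *: (delta_mx 0 i : 'rV[R]_n).
  rewrite [LHS]row_sum_delta; apply: eq_bigr => i _; by rewrite !mxE.
elim/big_rec: _ => [|i v _ <-]; first by rewrite addr0.
by rewrite (addrC _ v) addrA fint.
Qed.

Definition box : set 'rV[R]_n := [set v | forall i, v ord0 i \in `[0, 2 * pi]].

Lemma box_compact : compact box.
Proof. by apply: (@rV_compact _ _ (fun=> `[0, 2 * pi]%classic)) => i; exact: segment_compact. Qed.

Lemma box_reduce x :
  exists z : 'rV[int]_n, box (x - (2 * pi) *: map_mx intr z).
Proof.
have p0 : 0 < 2 * pi :> R by rewrite mulr_gt0 // pi_gt0.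
exists (\row_i Num.floor (x 0 i / (2 * pi))) => i.
rewrite !mxE /= in_itv /=.
have /andP[] := floor_itv (x 0 i / (2 * pi)).
move: (Num.floor _) => m; rewrite ler_pdivlMr // ltr_pdivrMr // intrD => h1 h2.
by apply/andP; split; lra.
Qed.

Lemma torus_ind f (P : R -> Prop) : torus_periodic f ->
  (forall x, box x -> P (f x)) -> forall x, P (f x).
Proof.
move=> fp H x; have [z zx] := box_reduce x.
by rewrite -(periodic_shift fp (- z)) map_mxN scalerN; exact: H.
Qed.

Lemma box_nonempty : box !=set0.
Proof.
exists 0 => i; rewrite /= mxE in_itv /= lexx /= mulr_ge0 //; exact: pi_ge0.
Qed.

Lemma torus_min f : torus_continuous f -> exists x0, forall x, f x0 <= f x.
Proof.
move=> [fp fc]; have [|x0 _ H] := EVT_min_rV box_nonempty box_compact (f := f).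
  exact: continuous_subspaceT.
exists x0; apply: (torus_ind (P := fun t => f x0 <= t)) => // x bx.
by apply: H; rewrite inE.
Qed.

Lemma torus_ucont f : torus_continuous f -> forall e, 0 < e ->
  exists2 d, 0 < d & forall x y, `|x - y| < d -> `|f x - f y| <= e.
Proof.
move=> [fp fc] e e0; have e20 : 0 < e / 2 by lra.
(* The second point ranges over the whole space, so that only [x] has to be moved into the box, by a
   lattice translation applied to both points. *)
pose P (d : R) x := forall y, `|x - y| < d -> `|f x - f y| <= e.
have /compact_near_coveringP/(_ R (0^'+) P _) := box_compact.
case=> [x bx|].
  have [d d0 Hd] := iffLR (continuous_epsP f) fc x _ e20.
  have d20 : 0 < d / 2 by lra.
  exists (ball x (d / 2), [set t | t < d / 2]) => /=.
    by split; [exact: nbhsx_ballx|exact: nbhs_right_lt].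
  move=> [x' t] /= []; rewrite -ball_normE /= => xx' td y xy.
  have h1 := Hd x' ltac:(lra).
  have h2 : `|x - y| < d.
    by rewrite -(subrK x' x) -addrA (le_lt_trans (ler_normD _ _)) //; lra.
  have {}h2 := Hd y h2.
  rewrite -(subrK (f x) (f x')) -addrA (le_trans (ler_normD _ _)) //.
  by rewrite distrC; lra.
move=> d /= d0 H.
have d20 : 0 < d / 2 by lra.
exists (d / 2) => // x y xy; have [z zx] := box_reduce x.
have := H (d / 2) _ d20 _ zx (y - (2 * pi) *: map_mx intr z).
rewrite opprB addrA subrK -scalerN -map_mxN !periodic_shift //; apply => //=.
by rewrite /ball /= sub0r normrN gtr0_norm //; lra.
Qed.

Lemma torus_bounded f : torus_continuous f ->
  exists2 M, 0 <= M & forall x, `|f x| <= M.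
Proof.
move=> fc; have [x1 m1] := torus_min fc.
have [|x2 m2] := @torus_min (fun x => - f x).
  case: fc => fp fc; split=> [i x|]; first by rewrite fp.
  apply/continuous_epsP => x e e0.
  have [d d0 H] := iffLR (continuous_epsP f) fc x e e0.
  by exists d => // y /H; rewrite -opprD normrN.
exists (`|f x1| + `|f x2|) => [|x]; first exact: addr_ge0.
have := m1 x; have := m2 x; rewrite lerN2 => a b.
have := ler_norm (f x2); have := ler_norm (- f x1).
rewrite normrN => c d; rewrite ler_norml.
by have := normr_ge0 (f x1); have := normr_ge0 (f x2) => *; apply/andP; split; lra.
Qed.

End Periodic.

(** * Linearity and monotonicity of the iterated integral *)

Section TorusInt.
Context {R : realType}.

Definition unif_cont {n : nat} (f : 'rV[R]_n -> R) := forall e, 0 < e ->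
  exists2 d, 0 < d & forall x y, `|x - y| < d -> `|f x - f y| <= e.

Lemma unif_cont_lin {n : nat} (a : R) (f g : 'rV[R]_n -> R) :
  unif_cont f -> unif_cont g -> unif_cont (fun x => a * f x + g x).
Proof.
move=> uf ug e e0.
have a1 : 0 < `|a| + 1 by rewrite ltr_wpDl.
have e1 : 0 < e / 2 / (`|a| + 1) by rewrite divr_gt0 //; lra.
have e2 : 0 < e / 2 by lra.
have [d1 d10 H1] := uf _ e1; have [d2 d20 H2] := ug _ e2.
exists (Order.min d1 d2) => [|x y]; first by rewrite lt_min d10.
rewrite lt_min => /andP[/H1 h1 /H2 h2].
have -> : a * f x + g x - (a * f y + g y) = a * (f x - f y) + (g x - g y) by ring.
rewrite (le_trans (ler_normD _ _)) // normrM.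
have : `|a| * `|f x - f y| <= e / 2.
  rewrite (le_trans (ler_wpM2l (normr_ge0 a) h1)) // mulrA ler_pdivrMr //.
  by rewrite [leRHS]mulrDr mulr1 (mulrC `|a|) lerDl ltW.
lra.
Qed.

Lemma unif_cont_cst {n : nat} (c : R) : unif_cont (fun _ : 'rV[R]_n => c).
Proof. by move=> e e0; exists 1 => // x y _; rewrite subrr normr0 ltW. Qed.

Lemma row_mx_dist {m : nat} (t s : R) (x y : 'rV[R]_m) (d : R) :
  `|t - s| <= d -> `|x - y| <= d ->
  `|(row_mx t%:M x : 'rV_m.+1) - row_mx s%:M y| <= d.
Proof.
move=> ts xy; apply: ler_rV_norm => [|i]; first exact: le_trans ts.
rewrite !mxE; case: (split_ordP (i : 'I_(1 + m))) => j _.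
  by rewrite !mxE ord1 !eqxx.
by have := rV_coord_le (x - y) j; rewrite !mxE => /le_trans; apply.
Qed.

Lemma unif_cont_row {m : nat} (f : 'rV[R]_m.+1 -> R) (t : R) : unif_cont f ->
  unif_cont (fun x => f (row_mx (t%:M : 'rV_1) x)).
Proof.
move=> uf e e0; have [d d0 H] := uf e e0; exists d => // x y xy.
apply: H; apply: le_lt_trans xy.
by apply: row_mx_dist => //; rewrite subrr normr0.
Qed.

Lemma itv_integrable (f : R -> R) (a b : R) : continuous f ->
  (@lebesgue_measure R).-integrable `[a, b] (EFin \o f).
Proof.
move=> cf; apply: continuous_compact_integrable; first exact: segment_compact.
exact: continuous_subspaceT.
Qed.

(** The three properties go through one induction: in dimension [m] they make the inner integral
    continuous in the first coordinate, and this continuity makes the outer integrand integrable. *)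
Lemma torus_int_spec (n : nat) :
  [/\ forall (a : R) (f g : 'rV[R]_n -> R), unif_cont f -> unif_cont g ->
        torus_int (fun x => a * f x + g x) = a * torus_int f + torus_int g,
      forall f g : 'rV[R]_n -> R, unif_cont f -> unif_cont g ->
        (forall x, f x <= g x) -> torus_int f <= torus_int g
    & forall c : R, torus_int (fun _ : 'rV[R]_n => c) = c * (2 * pi) ^+ n].
Proof.
have p0 : 0 < 2 * pi :> R by rewrite mulr_gt0 // pi_gt0.
elim: n => [|m [IHl IHm IHc]].
  by split=> //= c; rewrite expr0 mulr1.
have cts (f : 'rV[R]_m.+1 -> R) : unif_cont f ->
    continuous (fun t : R => torus_int (fun x : 'rV[R]_m => f (row_mx (t%:M : 'rV_1) x))).
  move=> uf t; apply/cvgrPdist_le => e e0.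
  have c0 : 0 < (2 * pi) ^+ m :> R by rewrite exprn_gt0.
  have [|d d0 H] := uf (e / (2 * pi) ^+ m); first exact: divr_gt0.
  apply/nbhs_ballP; exists d => //= s; rewrite /ball /= => ts.
  have hr := unif_cont_row _ uf.
  have ud : unif_cont (fun x : 'rV[R]_m => -1 * f (row_mx (s%:M : 'rV_1) x)
      + f (row_mx (t%:M : 'rV_1) x)).
    exact: unif_cont_lin.
  rewrite addrC -mulN1r -IHl; [|exact: hr..].
  have bd x : `|-1 * f (row_mx (s%:M : 'rV_1) x) + f (row_mx (t%:M : 'rV_1) x)|
      <= e / (2 * pi) ^+ m.
    rewrite mulN1r addrC; apply: H; apply: le_lt_trans ts.
    by apply: row_mx_dist => //; rewrite subrr normr0.
  rewrite ler_norml; apply/andP; split.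
  - have -> : - e = torus_int (fun _ : 'rV[R]_m => - (e / (2 * pi) ^+ m)).
      by rewrite IHc mulNr divfK // gt_eqF.
    apply: IHm => //; first exact: unif_cont_cst.
    by move=> x; have /ler_normlP[] := bd x; rewrite lerNl.
  - have -> : e = torus_int (fun _ : 'rV[R]_m => e / (2 * pi) ^+ m).
      by rewrite IHc divfK // gt_eqF.
    apply: IHm => //; first exact: unif_cont_cst.
    by move=> x; have /ler_normlP[] := bd x.
split=> /=.
- move=> a f g uf ug.
  transitivity (\int[@lebesgue_measure R]_(t in `[0, (2 * pi)%R])
     (a * torus_int (fun x : 'rV[R]_m => f (row_mx (t%:M : 'rV_1) x)) +
      torus_int (fun x : 'rV[R]_m => g (row_mx (t%:M : 'rV_1) x)))).
    by apply: eq_Rintegral => t _; rewrite IHl //; exact: unif_cont_row.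
  have If := itv_integrable 0 (2 * pi) (cts _ uf).
  have Ig := itv_integrable 0 (2 * pi) (cts _ ug).
  rewrite RintegralD //; last first.
    apply: (itv_integrable 0 (2 * pi)) => t.
    apply: (@cvgM _ _ _ _ (fun=> a)); first exact: cvg_cst.
    exact: cts.
  by rewrite RintegralZl.
- move=> f g uf ug fg; apply: le_Rintegral => //; try exact/itv_integrable/cts.
  by move=> t _; apply: IHm => //; exact: unif_cont_row.
- move=> c; under eq_Rintegral do rewrite IHc.
  rewrite Rintegral_cst // [X in fine X](_ : _ = (2 * pi)%:E).
    by rewrite exprSr mulrA.
  have := @lebesgue_measure_itv R `[0, 2 * pi].
  by rewrite /= lte_fin p0 oppr0 adde0.
Qed.

End TorusInt.

(** * The normalized integral over the torus *)

Section Mean.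
Context {R : realType} {n : nat}.
Implicit Types (f g : 'rV[R]_n -> R) (a c : R).

Definition mean f : R := (2 * pi) ^- n * torus_int f.

Lemma mean_cst c : mean (fun=> c) = c.
Proof.
have p0 : 0 < 2 * pi :> R by rewrite mulr_gt0 // pi_gt0.
rewrite /mean; have [_ _ ->] := @torus_int_spec R n.
by rewrite mulrC mulfK // expf_neq0 // gt_eqF.
Qed.

Lemma mean_le f g : torus_continuous f -> torus_continuous g ->
  (forall x, f x <= g x) -> mean f <= mean g.
Proof.
have p0 : 0 < 2 * pi :> R by rewrite mulr_gt0 // pi_gt0.
move=> /torus_ucont uf /torus_ucont ug fg; rewrite /mean.
rewrite ler_pM2l ?invr_gt0 ?exprn_gt0 //.
by have [_ H _] := @torus_int_spec R n; exact: H.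
Qed.

Lemma mean_lin a f g : torus_continuous f -> torus_continuous g ->
  mean (fun x => a * f x + g x) = a * mean f + mean g.
Proof.
move=> /torus_ucont uf /torus_ucont ug; rewrite /mean.
have [-> // _ _] := @torus_int_spec R n.
by rewrite mulrDr mulrCA.
Qed.

Lemma torus_continuous_cst c : torus_continuous (fun _ : 'rV[R]_n => c).
Proof. by split=> //; exact: cst_continuous. Qed.

Lemma torus_continuousD f g : torus_continuous f -> torus_continuous g ->
  torus_continuous (fun x => f x + g x).
Proof.
move=> [fp fc] [gp gc]; split=> [i x|x]; first by rewrite fp gp.
exact: (cvgD (fc x) (gc x)).
Qed.

Lemma torus_continuousM f g : torus_continuous f -> torus_continuous g ->
  torus_continuous (fun x => f x * g x).
Proof.
move=> [fp fc] [gp gc]; split=> [i x|x]; first by rewrite fp gp.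
exact: (cvgM (fc x) (gc x)).
Qed.

Lemma torus_continuousZ c f : torus_continuous f ->
  torus_continuous (fun x => c * f x).
Proof. by apply: torus_continuousM; exact: torus_continuous_cst. Qed.

Lemma torus_continuousN f : torus_continuous f -> torus_continuous (fun x => - f x).
Proof.
move=> [fp fc]; split=> [i x|x]; first by rewrite fp.
exact: (cvgN (fc x)).
Qed.

Lemma torus_continuousB f g : torus_continuous f -> torus_continuous g ->
  torus_continuous (fun x => f x - g x).
Proof. by move=> fc gc; apply: torus_continuousD => //; exact: torus_continuousN. Qed.

Lemma torus_continuous_sum (I : Type) (r : seq I) (F : I -> 'rV[R]_n -> R) :
  (forall i, torus_continuous (F i)) ->
  torus_continuous (fun x => \sum_(i <- r) F i x).
Proof.
move=> Fc; elim: r => [|i r IH].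
  rewrite (_ : (fun x => _) = fun=> 0); first exact: torus_continuous_cst.
  by apply/funext => x; rewrite big_nil.
rewrite (_ : (fun x => _) = fun x => F i x + \sum_(i <- r) F i x).
  exact: torus_continuousD.
by apply/funext => x; rewrite big_cons.
Qed.

Lemma meanD f g : torus_continuous f -> torus_continuous g ->
  mean (fun x => f x + g x) = mean f + mean g.
Proof.
move=> fc gc; rewrite -[mean f]mul1r -mean_lin //.
by congr mean; apply/funext => x; rewrite mul1r.
Qed.

Lemma meanZ c f : torus_continuous f -> mean (fun x => c * f x) = c * mean f.
Proof.
move=> fc; have := mean_lin c fc (torus_continuous_cst 0).
rewrite mean_cst addr0 => <-.
by congr mean; apply/funext => x; rewrite addr0.
Qed.

Lemma meanN f : torus_continuous f -> mean (fun x => - f x) = - mean f.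
Proof.
move=> fc; rewrite -mulN1r -meanZ //.
by congr mean; apply/funext => x; rewrite mulN1r.
Qed.

Lemma meanB f g : torus_continuous f -> torus_continuous g ->
  mean (fun x => f x - g x) = mean f - mean g.
Proof. by move=> fc gc; rewrite meanD ?meanN //; exact: torus_continuousN. Qed.

Lemma mean_sum (I : Type) (r : seq I) (F : I -> 'rV[R]_n -> R) :
  (forall i, torus_continuous (F i)) ->
  mean (fun x => \sum_(i <- r) F i x) = \sum_(i <- r) mean (F i).
Proof.
move=> Fc; elim: r => [|i r IH].
  rewrite big_nil -[RHS](mean_cst 0); congr mean.
  by apply/funext => x; rewrite big_nil.
rewrite big_cons -IH -meanD //; last exact: torus_continuous_sum.
by congr mean; apply/funext => x; rewrite big_cons.
Qed.

Lemma mean_ge0 f : torus_continuous f -> (forall x, 0 <= f x) -> 0 <= mean f.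
Proof.
move=> fc f0; rewrite -(mean_cst 0); apply: mean_le => //.
exact: torus_continuous_cst.
Qed.

Lemma mean_norm_le c f : torus_continuous f -> (forall x, `|f x| <= c) ->
  `|mean f| <= c.
Proof.
move=> fc fb; rewrite ler_norml; apply/andP; split.
  rewrite -[leLHS]mean_cst; apply: mean_le => // [|x].
    exact: torus_continuous_cst.
  by have /ler_normlP[] := fb x; rewrite lerNl.
rewrite -[leRHS]mean_cst; apply: mean_le => // [|x].
  exact: torus_continuous_cst.
by have /ler_normlP[] := fb x.
Qed.

End Mean.

(** * Frequencies and the continuity of the characters *)

Section Frequencies.
Context {R : realType} {n : nat}.
Implicit Types (k l : 'rV[int]_n) (x y : 'rV[R]_n).

Lemma freq_dotDl k l x : freq_dot (k + l) x = freq_dot k x + freq_dot l x.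
Proof.
rewrite /freq_dot -big_split; apply: eq_bigr => i _.
by rewrite mxE intrD mulrDl.
Qed.

Lemma freq_dotNl k x : freq_dot (- k) x = - freq_dot k x.
Proof.
rewrite /freq_dot -sumrN; apply: eq_bigr => i _; by rewrite mxE mulrNz mulNr.
Qed.

Lemma freq_dotBl k l x : freq_dot (k - l) x = freq_dot k x - freq_dot l x.
Proof. by rewrite freq_dotDl freq_dotNl. Qed.

Lemma freq_dot0l x : freq_dot 0 x = 0.
Proof. by rewrite /freq_dot big1 // => i _; rewrite mxE mul0r. Qed.

Lemma freq_dotDr k x y : freq_dot k (x + y) = freq_dot k x + freq_dot k y.
Proof.
rewrite /freq_dot -big_split; apply: eq_bigr => i _.
by rewrite mxE mulrDr.
Qed.

Lemma freq_dotZr k a x : freq_dot k (a *: x) = a * freq_dot k x.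
Proof.
rewrite /freq_dot mulr_sumr; apply: eq_bigr => i _; by rewrite mxE mulrCA.
Qed.

Lemma freq_dotBr k x y : freq_dot k (x - y) = freq_dot k x - freq_dot k y.
Proof. by rewrite freq_dotDr -scaleN1r freq_dotZr mulN1r. Qed.

Lemma freq_dot_delta k i : freq_dot k (delta_mx 0 i) = (k 0 i)%:~R :> R.
Proof.
rewrite /freq_dot (bigD1 i) //= mxE !eqxx mulr1 big1 ?addr0 // => j ji.
by rewrite mxE eqxx (negPf ji) mulr0.
Qed.

Lemma freq_dot_deltal i x : freq_dot (delta_mx 0 i) x = x 0 i.
Proof.
rewrite /freq_dot (bigD1 i) //= mxE !eqxx mul1r big1 ?addr0 // => j ji.
by rewrite mxE eqxx (negPf ji) mul0r.
Qed.

Lemma freq_dot_lipschitz k x y :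
  `|freq_dot k x - freq_dot k y| <= (\sum_i `|(k 0 i)%:~R : R|) * `|x - y|.
Proof.
rewrite -freq_dotBr /freq_dot mulr_suml (le_trans (ler_norm_sum _ _ _)) //.
by apply: ler_sum => i _; rewrite normrM ler_wpM2l // rV_coord_le.
Qed.

Lemma continuous_freq_dot k : continuous (freq_dot k : 'rV[R]_n -> R).
Proof.
apply/continuous_epsP => x e e0; set S := \sum_i `|(k 0 i)%:~R : R|.
have S0 : 0 <= S by apply: sumr_ge0.
exists (e / (S + 1)) => [|y xy]; first by rewrite divr_gt0 // ltr_wpDl.
rewrite (le_trans (freq_dot_lipschitz _ _ _)) // -/S.
have : (S + 1) * `|x - y| <= e by rewrite mulrC -ler_pdivlMr ?ltW // ltr_wpDl.
by have := normr_ge0 (x - y); lra.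
Qed.

Lemma cosD2piz (t : R) (m : int) : cos (t + 2 * pi * m%:~R) = cos t.
Proof.
have cosn (p : nat) (s : R) : cos (s + 2 * pi * p%:R) = cos s.
  by rewrite mulr_natr (mulr_natl pi 2) (periodicn (@cosD2pi R)).
case: m => p; first exact: cosn.
by rewrite NegzE -(cosn p.+1) mulrNz mulrN subrK.
Qed.

Lemma sinD2piz (t : R) (m : int) : sin (t + 2 * pi * m%:~R) = sin t.
Proof.
have sinn (p : nat) (s : R) : sin (s + 2 * pi * p%:R) = sin s.
  by rewrite mulr_natr (mulr_natl pi 2) (periodicn (@sinD2pi R)).
case: m => p; first exact: sinn.
by rewrite NegzE -(sinn p.+1) mulrNz mulrN subrK.
Qed.

Lemma torus_continuous_cos k : torus_continuous (fun x : 'rV[R]_n => cos (freq_dot k x)).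
Proof.
split=> [i x|x].
  by rewrite freq_dotDr freq_dotZr freq_dot_delta cosD2piz.
by apply: continuous_comp; [exact: continuous_freq_dot|exact: continuous_cos].
Qed.

Lemma torus_continuous_sin k : torus_continuous (fun x : 'rV[R]_n => sin (freq_dot k x)).
Proof.
split=> [i x|x].
  by rewrite freq_dotDr freq_dotZr freq_dot_delta sinD2piz.
by apply: continuous_comp; [exact: continuous_freq_dot|exact: continuous_sin].
Qed.

End Frequencies.

(** * Integrals of the characters *)

Section TrigIntegrals.
Context {R : realType}.

Lemma continuous_cosM (c : R) : continuous (fun t : R => cos (c * t)).
Proof.
move=> t; apply: (@continuous_comp R R R (fun s => c * s) cos t).
  exact: mulrl_continuous.
exact: continuous_cos.
Qed.

Lemma continuous_sinM (c : R) : continuous (fun t : R => sin (c * t)).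
Proof.
move=> t; apply: (@continuous_comp R R R (fun s => c * s) sin t).
  exact: mulrl_continuous.
exact: continuous_sin.
Qed.

Lemma Rint_cos (m : int) : \int[@lebesgue_measure R]_(t in `[0, 2 * pi])
  cos (m%:~R * t) = (m == 0)%:R * (2 * pi).
Proof.
have p0 : 0 < 2 * pi :> R by rewrite mulr_gt0 // pi_gt0.
have [->|m0] := eqVneq m 0.
  under eq_Rintegral do rewrite mul0r cos0.
  rewrite Rintegral_cst // [X in fine X](_ : _ = (2 * pi)%:E) //.
  have := @lebesgue_measure_itv R `[0, 2 * pi].
  by rewrite /= lte_fin p0 oppr0 adde0.
have m1 : m%:~R != 0 :> R by rewrite intr_eq0.
pose F t : R := m%:~R^-1 * sin (m%:~R * t).
have dF (t : R) : is_derive t (1 : R) F (cos (m%:~R * t)).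
  rewrite /F; apply: is_derive_eq.
  by rewrite /GRing.scale /= mulr1 mulrCA mulVf // mulr1.
have cF : continuous F.
  by move=> t; apply/differentiable_continuous/derivable1_diffP; have [] := dF t.
rewrite /Rintegral (continuous_FTC2 (F := F)) //=.
- rewrite /F mulr0 sin0 mulr0 subr0.
  by rewrite (mulrC m%:~R) -(add0r (_ * m%:~R)) sinD2piz sin0 mulr0 mul0r.
- exact/continuous_subspaceT/continuous_cosM.
- split=> [t _||].
  + by have [] := dF t.
  + exact/cvg_at_right_filter/cF.
  + exact/cvg_at_left_filter/cF.
- by move=> t _; rewrite derive1E; have [_ ->] := dF t.
Qed.

Lemma Rint_sin (m : int) : \int[@lebesgue_measure R]_(t in `[0, 2 * pi])
  sin (m%:~R * t) = 0.
Proof.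
have p0 : 0 < 2 * pi :> R by rewrite mulr_gt0 // pi_gt0.
have [->|m0] := eqVneq m 0.
  under eq_Rintegral do rewrite mul0r sin0.
  by rewrite Rintegral_cst // mul0r.
have m1 : m%:~R != 0 :> R by rewrite intr_eq0.
pose F t : R := - m%:~R^-1 * cos (m%:~R * t).
have dF (t : R) : is_derive t (1 : R) F (sin (m%:~R * t)).
  rewrite /F; apply: is_derive_eq.
  by rewrite /GRing.scale /= mulr1 !mulNr mulrN opprK mulrCA mulVf // mulr1.
have cF : continuous F.
  by move=> t; apply/differentiable_continuous/derivable1_diffP; have [] := dF t.
rewrite /Rintegral (continuous_FTC2 (F := F)) //=.
- rewrite /F mulr0 cos0.
  by rewrite (mulrC m%:~R) -(add0r (_ * m%:~R)) cosD2piz cos0 subrr.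
- exact/continuous_subspaceT/continuous_sinM.
- split=> [t _||].
  + by have [] := dF t.
  + exact/cvg_at_right_filter/cF.
  + exact/cvg_at_left_filter/cF.
- by move=> t _; rewrite derive1E; have [_ ->] := dF t.
Qed.

Lemma freq_dot_row_mx (m : nat) (k : 'rV[int]_m.+1) (t : R) (x : 'rV[R]_m) :
  freq_dot k (row_mx t%:M x : 'rV_m.+1) =
  (k 0 ord0)%:~R * t + freq_dot (\row_j k 0 (lift ord0 j)) x.
Proof.
rewrite /freq_dot big_ord_recl; congr (_ * _ + _).
  rewrite (_ : ord0 = lshift m (ord0 : 'I_1)); last exact: val_inj.
  by rewrite (@row_mxEl _ 1 1 m) mxE eqxx.
apply: eq_bigr => j _; rewrite mxE; congr (_ * _).
rewrite (_ : lift ord0 j = rshift 1 j); last exact: val_inj.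
by rewrite (@row_mxEr _ 1 1 m).
Qed.

(** The addition formulas split off the first coordinate but mix sine and cosine; hence both
    integrals are computed in one induction. *)
Lemma torus_int_trig (n : nat) (k : 'rV[int]_n) :
  torus_int (fun x : 'rV[R]_n => cos (freq_dot k x)) = (k == 0)%:R * (2 * pi) ^+ n /\
  torus_int (fun x : 'rV[R]_n => sin (freq_dot k x)) = 0.
Proof.
elim: n k => [|m IH] k.
  have -> : k = 0 by apply/rowP => -[].
  by rewrite /= eqxx mul1r expr0 !freq_dot0l cos0 sin0.
pose k' : 'rV[int]_m := \row_j k 0 (lift ord0 j).
have [IHc IHs] := IH k'.
have kE : (k == 0) = (k 0 ord0 == 0) && (k' == 0).
  apply/eqP/andP => [k0|[/eqP h0 /eqP h1]].
    by split; apply/eqP; [|apply/rowP => j]; rewrite ?mxE k0 mxE.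
  apply/rowP => j; rewrite mxE; case: (unliftP ord0 j) => [i ->|->]; last by rewrite h0.
  by have /rowP/(_ i) := h1; rewrite !mxE.
have uc := torus_ucont (@torus_continuous_cos R m k').
have us := torus_ucont (@torus_continuous_sin R m k').
(* The inner integral, with the trigonometric functions of the first coordinate frozen as [A] and
   [B]. *)
have lin A B : torus_int (fun x : 'rV[R]_m =>
    A * cos (freq_dot k' x) + B * sin (freq_dot k' x)) =
    A * ((k' == 0)%:R * (2 * pi) ^+ m).
  have [H _ cst] := @torus_int_spec R m.
  have zs : unif_cont (fun x : 'rV[R]_m => B * sin (freq_dot k' x) + 0).
    by apply: unif_cont_lin => //; exact: unif_cont_cst.
  rewrite -[RHS]addr0 -IHc -[X in _ = _ + X](mulr0 B) -[X in _ = _ + B * X]IHs.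
  rewrite -[X in _ = _ + X]addr0 -[X in _ = _ + (_ + X)](mul0r ((2 * pi) ^+ m)).
  rewrite -cst -H //; last exact: unif_cont_cst.
  by rewrite -H //; congr torus_int; apply/funext => x; rewrite addr0.
split=> /=.
- transitivity (\int[@lebesgue_measure R]_(t in `[0, (2 * pi)%R])
      ((k' == 0)%:R * (2 * pi) ^+ m * cos ((k 0 ord0)%:~R * t))).
    apply: eq_Rintegral => t _.
    rewrite [RHS]mulrC -(lin _ (- sin ((k 0 ord0)%:~R * t))).
    by congr torus_int; apply/funext => x; rewrite freq_dot_row_mx cosD mulNr.
  rewrite RintegralZl //; last first.
    exact/itv_integrable/continuous_cosM.
  rewrite Rint_cos kE.
  case: (k 0 ord0 == 0); case: (k' == 0) => /=;
    by rewrite ?mul0r ?mulr0 ?mul1r // exprSr.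
- transitivity (\int[@lebesgue_measure R]_(t in `[0, (2 * pi)%R])
      ((k' == 0)%:R * (2 * pi) ^+ m * sin ((k 0 ord0)%:~R * t))).
    apply: eq_Rintegral => t _.
    rewrite [RHS]mulrC -(lin _ (cos ((k 0 ord0)%:~R * t))).
    by congr torus_int; apply/funext => x; rewrite freq_dot_row_mx sinD.
  rewrite RintegralZl //; last first.
    exact/itv_integrable/continuous_sinM.
  by rewrite Rint_sin mulr0.
Qed.

End TrigIntegrals.

(** * Real Fourier coefficients and the graph of the half-Laplacian *)

Section FourierCoefficients.
Context {R : realType} {n : nat}.
Implicit Types (f g h u v : 'rV[R]_n -> R) (k l : 'rV[int]_n) (x y : 'rV[R]_n).

Definition ccoef f k : R := mean (fun x => f x * cos (freq_dot k x)).
Definition scoef f k : R := mean (fun x => f x * sin (freq_dot k x)).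

Lemma half_laplacianP g h : is_half_laplacian g h <->
  forall k, ccoef h k = freq_norm R k * ccoef g k /\
            scoef h k = freq_norm R k * scoef g k.
Proof.
rewrite /is_half_laplacian /fourier_coef /ccoef /scoef /mean.
split=> H k; have := H k.
  move/eqP; rewrite eq_complex /= !mul0r subr0 addr0 mulrN eqr_opp.
  by move=> /andP[/eqP-> /eqP->].
move=> [hc hs]; apply/eqP; rewrite eq_complex /= hc hs.
by rewrite !mul0r subr0 addr0 mulrN !eqxx.
Qed.

(** The graph of A = (-Delta)^(1/2) on continuous functions. It is kept as a relation because A g
    need not be continuous when g is. *)
Definition half_lap g h :=
  [/\ torus_continuous g, torus_continuous h & is_half_laplacian g h].

Lemma coef_continuous f k : torus_continuous f ->
  torus_continuous (fun x => f x * cos (freq_dot k x)) /\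
  torus_continuous (fun x => f x * sin (freq_dot k x)).
Proof.
move=> fc; split; apply: torus_continuousM => //.
  exact: torus_continuous_cos.
exact: torus_continuous_sin.
Qed.

Lemma ccoef_lin a f g k : torus_continuous f -> torus_continuous g ->
  ccoef (fun x => a * f x + g x) k = a * ccoef f k + ccoef g k.
Proof.
move=> fc gc; have [f1 _] := coef_continuous k fc.
have [g1 _] := coef_continuous k gc.
rewrite /ccoef -mean_lin //; congr mean; apply/funext => x; ring.
Qed.

Lemma scoef_lin a f g k : torus_continuous f -> torus_continuous g ->
  scoef (fun x => a * f x + g x) k = a * scoef f k + scoef g k.
Proof.
move=> fc gc; have [_ f1] := coef_continuous k fc.
have [_ g1] := coef_continuous k gc.
rewrite /scoef -mean_lin //; congr mean; apply/funext => x; ring.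
Qed.

Lemma coef_bound f k c : torus_continuous f -> (forall x, `|f x| <= c) ->
  `|ccoef f k| <= c /\ `|scoef f k| <= c.
Proof.
move=> fc fb; have [f1 f2] := coef_continuous k fc.
split; apply: mean_norm_le => // x; rewrite normrM -[leRHS]mulr1;
  by rewrite ler_pM // ?cos_max ?sin_max.
Qed.

Lemma ccoef0 f : ccoef f 0 = mean f.
Proof.
by rewrite /ccoef; congr mean; apply/funext => x; rewrite freq_dot0l cos0 mulr1.
Qed.

Lemma freq_norm_ge0 k : 0 <= freq_norm R k.
Proof. exact: sqrtr_ge0. Qed.

Lemma freq_norm0 : freq_norm R (0 : 'rV[int]_n) = 0.
Proof. by rewrite /freq_norm big1 ?sqrtr0 // => i _; rewrite mxE expr0n. Qed.

Lemma freq_normN k : freq_norm R (- k) = freq_norm R k.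
Proof.
by rewrite /freq_norm; congr Num.sqrt; apply: eq_bigr => i _; rewrite mxE mulrNz sqrrN.
Qed.

Lemma freq_coord_le k i : `|(k 0 i)%:~R : R| <= freq_norm R k.
Proof.
rewrite /freq_norm -sqrtr_sqr ler_wsqrtr // (bigD1 i) //= lerDl.
by apply: sumr_ge0 => j _; exact: sqr_ge0.
Qed.

Lemma freq_norm_ge1 k : k != 0 -> 1 <= freq_norm R k.
Proof.
move=> k0; have /existsP[i ki] : [exists i, k 0 i != 0].
  apply: contraT; rewrite negb_exists => /forallP H.
  case/eqP: k0; apply/rowP => i; rewrite mxE.
  by have := H i; rewrite negbK => /eqP.
apply: le_trans (freq_coord_le k i).
rewrite -intr_norm -[1]/(1%:~R) ler_int.
by move: ki; rewrite -normr_gt0; case: `|_| => // -[].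
Qed.

Lemma half_lap_mean g h : half_lap g h -> mean h = 0.
Proof.
move=> [gc hc /half_laplacianP/(_ 0)[H _]].
by move: H; rewrite !ccoef0 freq_norm0 mul0r.
Qed.

Lemma half_lap_lin a u h v g : half_lap u h -> half_lap v g ->
  half_lap (fun x => a * u x + v x) (fun x => a * h x + g x).
Proof.
move=> [uc hc /half_laplacianP H] [vc gc /half_laplacianP G].
split.
- by apply: torus_continuousD => //; exact: torus_continuousZ.
- by apply: torus_continuousD => //; exact: torus_continuousZ.
- apply/half_laplacianP => k; have [H1 H2] := H k; have [G1 G2] := G k.
  by rewrite !ccoef_lin // !scoef_lin // H1 H2 G1 G2; split; ring.
Qed.

Lemma mean_cos k : mean (fun x : 'rV[R]_n => cos (freq_dot k x)) = (k == 0)%:R.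
Proof.
have p0 : 0 < 2 * pi :> R by rewrite mulr_gt0 // pi_gt0.
by rewrite /mean (torus_int_trig k).1 mulrC mulfK // expf_neq0 // gt_eqF.
Qed.

Lemma mean_sin k : mean (fun x : 'rV[R]_n => sin (freq_dot k x)) = 0.
Proof. by rewrite /mean (torus_int_trig k).2 mulr0. Qed.

Lemma mean_coscos k l :
  mean (fun x : 'rV[R]_n => cos (freq_dot k x) * cos (freq_dot l x)) =
  2^-1 * ((k == - l)%:R + (k == l)%:R).
Proof.
rewrite -(subr_eq0 k l) -(subr_eq0 k) opprK -!mean_cos.
rewrite -meanD; try exact: torus_continuous_cos.
rewrite -meanZ; last by apply: torus_continuousD; exact: torus_continuous_cos.
congr mean; apply/funext => x; rewrite freq_dotBl freq_dotDl cosD cosB; lra.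
Qed.

Lemma mean_sinsin k l :
  mean (fun x : 'rV[R]_n => sin (freq_dot k x) * sin (freq_dot l x)) =
  2^-1 * ((k == l)%:R - (k == - l)%:R).
Proof.
rewrite -(subr_eq0 k l) -(subr_eq0 k) opprK -!mean_cos.
rewrite -meanB; try exact: torus_continuous_cos.
rewrite -meanZ; last by apply: torus_continuousB; exact: torus_continuous_cos.
congr mean; apply/funext => x; rewrite freq_dotBl freq_dotDl cosB cosD; lra.
Qed.

Lemma mean_sincos k l :
  mean (fun x : 'rV[R]_n => sin (freq_dot k x) * cos (freq_dot l x)) = 0.
Proof.
have := meanD (torus_continuous_sin (R := R) (k + l)) (torus_continuous_sin (k - l)).
rewrite !mean_sin addr0 => E.
rewrite -[RHS](mulr0 2^-1) -E -meanZ; last first.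
  by apply: torus_continuousD; exact: torus_continuous_sin.
congr mean; apply/funext => x; rewrite freq_dotBl freq_dotDl sinD sinB; lra.
Qed.

Lemma half_lap_cos k : half_lap (fun x => cos (freq_dot k x))
  (fun x => freq_norm R k * cos (freq_dot k x)).
Proof.
have cc := @torus_continuous_cos R n k.
have zc := @torus_continuous_cst R n 0.
split=> //; first exact: torus_continuousZ.
apply/half_laplacianP => l.
have -> : (fun x => freq_norm R k * cos (freq_dot k x)) =
    (fun x => freq_norm R k * cos (freq_dot k x) + 0).
  by apply/funext => x; rewrite addr0.
rewrite ccoef_lin // scoef_lin //.
have -> : ccoef (fun=> 0) l = 0.
  rewrite /ccoef -[RHS](@mean_cst R n); congr mean; apply/funext => x; exact: mul0r.
have -> : scoef (fun=> 0) l = 0.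
  rewrite /scoef -[RHS](@mean_cst R n); congr mean; apply/funext => x; exact: mul0r.
have -> : scoef (fun x => cos (freq_dot k x)) l = 0.
  by rewrite -(mean_sincos l k); congr mean; apply/funext => x; exact: mulrC.
rewrite !mulr0 !addr0; split=> //.
rewrite /ccoef mean_coscos.
(* The coefficient is nonzero at -k as well as at k, and both frequencies have the same norm. *)
have [->|_] := eqVneq k (- l); first by rewrite freq_normN.
by have [->|_] := eqVneq k l; last by rewrite addr0 !mulr0.
Qed.

Lemma half_lap_sin k : half_lap (fun x => sin (freq_dot k x))
  (fun x => freq_norm R k * sin (freq_dot k x)).
Proof.
have cc := @torus_continuous_sin R n k.
have zc := @torus_continuous_cst R n 0.
split=> //; first exact: torus_continuousZ.
apply/half_laplacianP => l.
have -> : (fun x => freq_norm R k * sin (freq_dot k x)) =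
    (fun x => freq_norm R k * sin (freq_dot k x) + 0).
  by apply/funext => x; rewrite addr0.
rewrite ccoef_lin // scoef_lin //.
have -> : ccoef (fun=> 0) l = 0.
  rewrite /ccoef -[RHS](@mean_cst R n); congr mean; apply/funext => x; exact: mul0r.
have -> : scoef (fun=> 0) l = 0.
  rewrite /scoef -[RHS](@mean_cst R n); congr mean; apply/funext => x; exact: mul0r.
have -> : ccoef (fun x => sin (freq_dot k x)) l = 0 by exact: mean_sincos.
rewrite !mulr0 !addr0; split=> //.
rewrite /scoef mean_sinsin.
have [->|_] := eqVneq k (- l); first by rewrite freq_normN.
by have [->|_] := eqVneq k l; last by rewrite subr0 !mulr0.
Qed.

Lemma half_lap_cst c : half_lap (fun _ : 'rV[R]_n => c) (fun=> 0).
Proof.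
(* The wave of frequency 0 is the constant 1, and c is (c - 1) times 1 plus 1. *)
have H := half_lap_cos 0; have := half_lap_lin (c - 1) H H.
congr half_lap; apply/funext => x; rewrite freq_dot0l cos0; first by ring.
by rewrite freq_norm0; ring.
Qed.

Lemma half_lapZ a u h : half_lap u h ->
  half_lap (fun x => a * u x) (fun x => a * h x).
Proof.
move=> H; have := half_lap_lin a H (half_lap_cst 0).
by congr half_lap; apply/funext => x; rewrite addr0.
Qed.

Lemma half_lapD u h v g : half_lap u h -> half_lap v g ->
  half_lap (fun x => u x + v x) (fun x => h x + g x).
Proof.
move=> H G; have := half_lap_lin 1 H G.
by congr half_lap; apply/funext => x; rewrite mul1r.
Qed.

Lemma half_lapB u h v g : half_lap u h -> half_lap v g ->
  half_lap (fun x => u x - v x) (fun x => h x - g x).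
Proof.
move=> H G; have := half_lap_lin (-1) G H.
by congr half_lap; apply/funext => x; rewrite mulN1r addrC.
Qed.

Lemma half_lap_sum (I : Type) (r : seq I) (F G : I -> 'rV[R]_n -> R) :
  (forall i, half_lap (F i) (G i)) ->
  half_lap (fun x => \sum_(i <- r) F i x) (fun x => \sum_(i <- r) G i x).
Proof.
move=> H; elim: r => [|i r IH].
  have := half_lap_cst 0.
  by congr half_lap; apply/funext => x; rewrite big_nil.
have := half_lapD (H i) IH.
by congr half_lap; apply/funext => x; rewrite big_cons.
Qed.

Definition wave (a b : R) k x := a * cos (freq_dot k x) + b * sin (freq_dot k x).

Lemma half_lap_wave a b k :
  half_lap (wave a b k) (fun x => freq_norm R k * wave a b k x).
Proof.
have := half_lap_lin a (half_lap_cos k) (half_lapZ b (half_lap_sin k)).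
by congr half_lap; apply/funext => x; rewrite /wave; ring.
Qed.

End FourierCoefficients.

(** * The Fejer kernel on the torus *)

Section Fejer.
Context {R : realType} {n : nat}.
Implicit Types (f : 'rV[R]_n -> R) (k l : 'rV[int]_n) (x y z : 'rV[R]_n).

Definition fejer_idx (N : nat) := {ffun 'I_n -> 'I_N.+1}.

Definition fejer_freq (N : nat) (j : fejer_idx N) : 'rV[int]_n :=
  \row_i (j i : nat)%:Z.

Definition fejer_weight (N : nat) : R := (\prod_(i < n) N.+1%:R)^-1.

(** This is |sum_j exp(i j.z)|^2 / (N+1)^n with j in the cube {0, ..., N}^n, the product of
    one-dimensional Fejer kernels. The usual weights 1 - |k_i| / (N+1) stay implicit: a frequency k
    is repeated as often as it is a difference j - l. *)
Definition fejer_kernel (N : nat) z : R := fejer_weight N *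
  \sum_(j : fejer_idx N) \sum_(l : fejer_idx N)
    cos (freq_dot (fejer_freq j - fejer_freq l) z).

Definition fejer (N : nat) f x : R := fejer_weight N *
  \sum_(j : fejer_idx N) \sum_(l : fejer_idx N)
    wave (ccoef f (fejer_freq j - fejer_freq l))
      (scoef f (fejer_freq j - fejer_freq l)) (fejer_freq j - fejer_freq l) x.

Lemma fejer_prod_gt0 (N : nat) : 0 < \prod_(i < n) N.+1%:R :> R.
Proof. by apply: prodr_gt0 => i _; rewrite ltr0n. Qed.

Lemma fejer_weight_gt0 N : 0 < fejer_weight N.
Proof. by rewrite invr_gt0 fejer_prod_gt0. Qed.

Lemma sum_fejer_idx N (F : 'I_n -> 'I_N.+1 -> R) :
  \sum_(j : fejer_idx N) \prod_i F i (j i) = \prod_i \sum_c F i c.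
Proof. by rewrite bigA_distr_bigA. Qed.

(** The double sum of cos(a_j - a_l) is the square of the sum of the cosines plus the square of the
    sum of the sines. *)
Lemma fejer_kernel_ge0 N z : 0 <= fejer_kernel N z.
Proof.
rewrite /fejer_kernel mulr_ge0 ?(ltW (fejer_weight_gt0 N)) //.
suff -> : \sum_(j : fejer_idx N) \sum_(l : fejer_idx N)
    cos (freq_dot (fejer_freq j - fejer_freq l) z) =
    (\sum_(j : fejer_idx N) cos (freq_dot (fejer_freq j) z)) ^+ 2 +
    (\sum_(j : fejer_idx N) sin (freq_dot (fejer_freq j) z)) ^+ 2.
  by apply: addr_ge0; exact: sqr_ge0.
rewrite !expr2 !mulr_suml -big_split; apply: eq_bigr => j _ /=.
rewrite !mulr_sumr -big_split; apply: eq_bigr => l _ /=.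
by rewrite freq_dotBl cosB.
Qed.

Lemma torus_continuous_cos_sub k x :
  torus_continuous (fun y : 'rV[R]_n => cos (freq_dot k (x - y))).
Proof.
rewrite (_ : (fun y => _) = fun y => cos (freq_dot k x) * cos (freq_dot k y) +
  sin (freq_dot k x) * sin (freq_dot k y)); last first.
  by apply/funext => y; rewrite freq_dotBr cosB.
by apply: torus_continuousD; apply: torus_continuousZ;
  [exact: torus_continuous_cos|exact: torus_continuous_sin].
Qed.

Lemma torus_continuous_fejer_kernel N x :
  torus_continuous (fun y => fejer_kernel N (x - y)).
Proof.
apply: torus_continuousZ; apply: torus_continuous_sum => j.
by apply: torus_continuous_sum => l; exact: torus_continuous_cos_sub.
Qed.

Lemma mean_mul_fejer_kernel N x f : torus_continuous f ->
  mean (fun y => f y * fejer_kernel N (x - y)) = fejer_weight N *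
  \sum_(j : fejer_idx N) \sum_(l : fejer_idx N)
    mean (fun y => f y * cos (freq_dot (fejer_freq j - fejer_freq l) (x - y))).
Proof.
move=> fc.
have fk k : torus_continuous (fun y => f y * cos (freq_dot k (x - y))).
  by apply: torus_continuousM => //; exact: torus_continuous_cos_sub.
transitivity (fejer_weight N * mean (fun y =>
    \sum_(j : fejer_idx N) \sum_(l : fejer_idx N)
    (f y * cos (freq_dot (fejer_freq j - fejer_freq l) (x - y))))).
  rewrite -meanZ; last first.
    by apply: torus_continuous_sum => j; exact: torus_continuous_sum.
  congr mean; apply/funext => y; rewrite /fejer_kernel mulrCA; congr (_ * _).
  by rewrite mulr_sumr; apply: eq_bigr => j _; rewrite mulr_sumr.
congr (_ * _); rewrite mean_sum => [|j]; last exact: torus_continuous_sum.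
by apply: eq_bigr => j _; rewrite mean_sum.
Qed.

(** Expanding cos(k.(x - y)) identifies the two forms of the Fejer mean. The convolution form gives
    positivity and approximation, the sum form the action of multipliers. *)
Lemma fejerE N f x : torus_continuous f ->
  fejer N f x = mean (fun y => f y * fejer_kernel N (x - y)).
Proof.
move=> fc; rewrite mean_mul_fejer_kernel //; congr (_ * _).
apply: eq_bigr => j _; apply: eq_bigr => l _; move: (_ - _) => k.
have [f1 f2] := coef_continuous k fc.
rewrite /wave /ccoef /scoef mulrC -meanZ // [X in _ + X]mulrC -meanZ //.
rewrite -meanD; [|exact: torus_continuousZ..]; congr mean.
by apply/funext => y; rewrite freq_dotBr cosB; ring.
Qed.

Lemma mean_cos_sub k x :
  mean (fun y : 'rV[R]_n => cos (freq_dot k (x - y))) = (k == 0)%:R.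
Proof.
transitivity (mean (fun y => cos (freq_dot k x) * cos (freq_dot k y) +
  sin (freq_dot k x) * sin (freq_dot k y))).
  by congr mean; apply/funext => y; rewrite freq_dotBr cosB.
have sc := @torus_continuous_sin R n k.
rewrite mean_lin; [|exact: torus_continuous_cos|exact: torus_continuousZ].
rewrite meanZ // mean_cos mean_sin mulr0 addr0.
by have [->|_] := eqVneq k 0; rewrite ?mulr0 // freq_dot0l cos0 mulr1.
Qed.

Lemma mean_cos_subM k l x :
  mean (fun y : 'rV[R]_n => cos (freq_dot l (x - y)) * cos (freq_dot k (x - y))) =
  2^-1 * ((k == - l)%:R + (k == l)%:R).
Proof.
rewrite -(subr_eq0 k l) -(subr_eq0 k) opprK -!(mean_cos_sub _ x).
rewrite -meanD; try exact: torus_continuous_cos_sub.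
rewrite -meanZ; last by apply: torus_continuousD; exact: torus_continuous_cos_sub.
congr mean; apply/funext => y.
by rewrite freq_dotBl freq_dotDl cosD cosB; lra.
Qed.

Lemma fejer_freq_inj N : injective (@fejer_freq N).
Proof.
move=> j l /rowP jl; apply/ffunP => i; have := jl i.
by rewrite !mxE => -[] /val_inj.
Qed.

(** Only the (N+1)^n diagonal pairs j = l have frequency 0. *)
Lemma mean_fejer_kernel N x : mean (fun y => fejer_kernel N (x - y)) = 1.
Proof.
transitivity (mean (fun y => 1 * fejer_kernel N (x - y))).
  by congr mean; apply/funext => y; rewrite mul1r.
rewrite mean_mul_fejer_kernel; last exact: torus_continuous_cst.
rewrite (eq_bigr (fun=> 1)) => [|j _].
  have -> : \sum_(j : fejer_idx N) 1 = \prod_(i < n) N.+1%:R :> R.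
    transitivity (\prod_(i < n) \sum_(c < N.+1) (1 : R)).
      rewrite -(sum_fejer_idx (fun _ _ => 1)).
      by apply: eq_bigr => j _; rewrite big1_eq.
    by apply: eq_bigr => i _; rewrite sumr_const card_ord.
  by rewrite mulVf // gt_eqF // fejer_prod_gt0.
rewrite (bigD1 j) //= big1 ?addr0 => [|l lj].
  rewrite subrr -[RHS](@mean_cst R n); congr mean; apply/funext => y.
  by rewrite freq_dot0l cos0 mulr1.
transitivity (mean (fun y : 'rV[R]_n => cos (freq_dot (fejer_freq j - fejer_freq l) (x - y)))).
  by congr mean; apply/funext => y; rewrite mul1r.
rewrite mean_cos_sub subr_eq0; case: eqP => // /fejer_freq_inj E.
by rewrite E eqxx in lj.
Qed.

(** Each l with l_i < N contributes the pair (l + e_i, l), and a proportion 1 - 1/(N+1) of the cube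
    consists of such l. *)
Lemma fejer_shift_count N (i : 'I_n) :
  \prod_(i < n) N.+1%:R * (1 - N.+1%:R^-1) <=
  \sum_(j : fejer_idx N) \sum_(l : fejer_idx N)
    (fejer_freq j - fejer_freq l == delta_mx 0 i)%:R :> R.
Proof.
have -> : \prod_(i < n) N.+1%:R * (1 - N.+1%:R^-1) =
    \sum_(l : fejer_idx N) (l i != ord_max)%:R :> R.
  transitivity (\sum_(l : fejer_idx N) \prod_i'
      (if i' == i then (l i' != ord_max)%:R else 1) : R); last first.
    apply: eq_bigr => l _; rewrite (bigD1 i) //= eqxx big1 ?mulr1 // => i' ii'.
    by rewrite (negPf ii').
  rewrite (sum_fejer_idx (fun i' c => if i' == i then (c != ord_max)%:R else 1)).
  rewrite (bigD1 i) //= [RHS](bigD1 i) //= mulrAC; congr (_ * _); last first.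
    by apply: eq_bigr => i' /negPf->; rewrite sumr_const card_ord.
  rewrite eqxx (bigD1 ord_max) //= eqxx add0r (eq_bigr (fun=> 1)); last first.
    by move=> c ->.
  rewrite mulrBr mulr1 mulfV ?pnatr_eq0 // sumr_const.
  have := cardC1 (ord_max : 'I_N.+1); rewrite card_ord /= => ->.
  by rewrite -natr1 addrK.
rewrite exchange_big /=; apply: ler_sum => l _.
have [li|li] := eqVneq (l i) ord_max; first by apply: sumr_ge0.
have liN : (l i < N)%N.
  by move: li; rewrite -val_eqE /= ltn_neqAle -ltnS ltn_ord => ->.
pose j : fejer_idx N := [ffun i' => if i' == i then inord (l i).+1 else l i'].
rewrite (bigD1 j) //= (_ : _ - _ == _); last first.
  apply/eqP/rowP => i'; rewrite !mxE eqxx ffunE /= eq_sym.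
  have [->|_] := eqVneq i' i; last by rewrite subrr.
  by rewrite inordK // -addn1 PoszD addrC addKr.
by rewrite lerDl; apply: sumr_ge0.
Qed.

(** The factor 1 - cos(x_i - y_i) measures the distance of x and y modulo the period in direction i.
    Its integral against the kernel is 1 minus the Fejer weight of e_i, which [fejer_shift_count]
    bounds from below. *)
Lemma mean_fejer_concentration N x (i : 'I_n) :
  mean (fun y => (1 - cos (x 0 i - y 0 i)) * fejer_kernel N (x - y)) <= N.+1%:R^-1.
Proof.
pose e : 'rV[int]_n := delta_mx 0 i.
have ec := torus_continuous_cos_sub e x.
have kc := torus_continuous_fejer_kernel N x.
apply: (@le_trans _ _ (mean (fun y => fejer_kernel N (x - y) -
    cos (freq_dot e (x - y)) * fejer_kernel N (x - y)))).
  rewrite le_eqVlt; apply/orP; left; apply/eqP; congr mean; apply/funext => y.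
  by rewrite freq_dot_deltal !mxE mulrBl mul1r.
rewrite meanB //; last exact: torus_continuousM.
rewrite mean_fejer_kernel mean_mul_fejer_kernel // lerBlDr -lerBlDl.
have C := fejer_shift_count N i.
have W := fejer_weight_gt0 N.
rewrite -(ler_pM2l W) mulrA [X in X * _]mulVf ?mul1r ?(gt_eqF (fejer_prod_gt0 _)) // in C.
apply: le_trans C _; rewrite ler_pM2l //.
under [X in _ <= X]eq_bigr do under eq_bigr do rewrite mean_cos_subM.
pose S k : R := \sum_(j : fejer_idx N) \sum_(l : fejer_idx N) (fejer_freq j - fejer_freq l == k)%:R.
rewrite [X in _ <= X](_ : _ = 2^-1 * (S (- e) + S e)); last first.
  rewrite /S -big_split mulr_sumr; apply: eq_bigr => j _ /=.
  by rewrite -big_split mulr_sumr.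
have -> : S (- e) = S e.
  rewrite /S exchange_big /=; apply: eq_bigr => j _; apply: eq_bigr => l _.
  by rewrite -(opprB (fejer_freq j)) eqr_opp.
by rewrite /S -/e; lra.
Qed.

End Fejer.

(** * Uniform convergence of Fejer means *)

Section FejerConvergence.
Context {R : realType} {n : nat}.
Implicit Types (f g h : 'rV[R]_n -> R) (k l : 'rV[int]_n) (x y z : 'rV[R]_n).

Lemma cos_gap (d t : R) : 0 < d <= pi ->
  exists m : int, cos d < cos t -> `|t - 2 * pi * m%:~R| < d.
Proof.
move=> /andP[d0 dpi]; have p0 : 0 < 2 * pi :> R by rewrite mulr_gt0 // pi_gt0.
(* This shift brings t into [-pi, pi), where the cosine decreases with the absolute value. *)
exists (Num.floor ((t + pi) / (2 * pi))).
have /andP[] := floor_itv ((t + pi) / (2 * pi)).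
move: (Num.floor _) => m; rewrite ler_pdivlMr // ltr_pdivrMr // intrD => h1 h2.
rewrite -(subrK (2 * pi * m%:~R) t) cosD2piz addrK.
set s := t - _; have spi : `|s| <= pi.
  by rewrite ler_norml /s; apply/andP; split; lra.
rewrite -(cos_norm s) ltr_cos // !in_itv /= ?spi ?normr_ge0 ?dpi ?ltW //.
Qed.

(** If all coordinates nearly agree modulo 2 pi, uniform continuity bounds the difference by e.
    Otherwise one term of the sum is at least 1 - cos s, and K is chosen so that K (1 - cos s) is
    the trivial bound 2 M. *)
Lemma torus_osc f (e : R) : torus_continuous f -> 0 < e ->
  exists2 K, 0 <= K & forall x y,
    `|f y - f x| <= e + K * \sum_i (1 - cos (x 0 i - y 0 i)).
Proof.
move=> fc e0; have [d d0 Hd] := torus_ucont fc e0.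
have [M M0 fM] := torus_bounded fc.
pose s := Order.min (d / 2) (pi : R).
have s0 : 0 < s by rewrite lt_min pi_gt0 divr_gt0.
have spi : s <= pi by rewrite ge_min lexx orbT.
have cs : cos s < 1.
  by rewrite -cos0 ltr_cos ?in_itv /= ?lexx ?pi_ge0 ?spi ?ltW.
have eta0 : 0 < 1 - cos s by rewrite subr_gt0.
have K0 : 0 <= 2 * M / (1 - cos s) by apply: divr_ge0; [exact: mulr_ge0|exact: ltW].
exists (2 * M / (1 - cos s)) => // x y.
have S0 (i : 'I_n) : 0 <= 1 - cos (x 0 i - y 0 i) by rewrite subr_ge0 cos_le1.
have [/forallP H|] := boolP [forall i, cos s < cos (x 0 i - y 0 i)].
  have /choice[z Hz] : forall i, exists m : int, `|x 0 i - y 0 i - 2 * pi * m%:~R| < s.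
    move=> i; have [|m Hm] := @cos_gap s (x 0 i - y 0 i); first by rewrite s0.
    by exists m; exact: Hm.
  apply: (@le_trans _ _ e); last by rewrite lerDl mulr_ge0 ?sumr_ge0.
  rewrite distrC -(periodic_shift fc.1 (\row_i z i) y); apply: Hd.
  apply: (@le_lt_trans _ _ (d / 2)); last by lra.
  apply: ler_rV_norm => [|i]; first by lra.
  rewrite !mxE opprD addrA; apply: le_trans (ltW (Hz i)) _.
  by rewrite /s ge_min lexx.
move=> /forallPn; case=> i; rewrite -leNgt => ci.
have h1 : `|f y - f x| <= 2 * M.
  by apply: le_trans (ler_normB _ _) _; have := fM x; have := fM y; lra.
have h2 : 1 - cos s <= \sum_i (1 - cos (x 0 i - y 0 i)).
  by rewrite (bigD1 i) //= -[leLHS]addr0 lerD ?sumr_ge0 // lerD2l lerN2.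
have := ler_wpM2l K0 h2; rewrite divfK ?gt_eqF //; lra.
Qed.

(** Integrating [torus_osc] against the kernel bounds the error by e/2 + K n / (N+1). *)
Lemma fejer_approx f (e : R) : torus_continuous f -> 0 < e ->
  exists N0, forall N, (N0 <= N)%N -> forall x, `|fejer N f x - f x| <= e.
Proof.
move=> fc e0; have [|K K0 HK] := @torus_osc f (e / 2) fc; first by lra.
have Kn0 : 0 <= K * n%:R by rewrite mulr_ge0.
exists (Num.bound (K * n%:R / (e / 2))) => N NN x.
have kc := torus_continuous_fejer_kernel N x.
have icos i : torus_continuous (fun y => 1 - cos (x 0 i - y 0 i)).
  apply: torus_continuousB; first exact: torus_continuous_cst.
  rewrite (_ : (fun y => _) = fun y => cos (freq_dot (delta_mx 0 i) (x - y))).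
    exact: torus_continuous_cos_sub.
  by apply/funext => y; rewrite freq_dot_deltal !mxE.
have sc : torus_continuous (fun y => \sum_i (1 - cos (x 0 i - y 0 i)) * fejer_kernel N (x - y)).
  by apply: torus_continuous_sum => i; exact: torus_continuousM.
have -> : fejer N f x - f x = mean (fun y => (f y - f x) * fejer_kernel N (x - y)).
  rewrite fejerE // -[X in _ - X]mulr1 -(mean_fejer_kernel N x) -meanZ //.
  rewrite -meanB; [|exact: torus_continuousM|exact: torus_continuousZ].
  by congr mean; apply/funext => y; rewrite mulrBl.
pose B y := e / 2 * fejer_kernel N (x - y) +
   K * \sum_i (1 - cos (x 0 i - y 0 i)) * fejer_kernel N (x - y).
have Bc : torus_continuous B.
  by apply: torus_continuousD; exact: torus_continuousZ.
have dc : torus_continuous (fun y => (f y - f x) * fejer_kernel N (x - y)).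
  apply: torus_continuousM => //; apply: torus_continuousB => //.
  exact: torus_continuous_cst.
have HB y : `|(f y - f x) * fejer_kernel N (x - y)| <= B y.
  have k0 := fejer_kernel_ge0 N (x - y).
  rewrite normrM (ger0_norm k0) /B -mulr_suml [K * _]mulrA -mulrDl.
  by rewrite ler_wpM2r.
have mB : mean B <= e.
  rewrite /B mean_lin //; last exact: torus_continuousZ.
  rewrite (meanZ K sc) mean_sum; last by move=> i; exact: torus_continuousM.
  rewrite mean_fejer_kernel mulr1.
  have : \sum_i mean (fun y => (1 - cos (x 0 i - y 0 i)) * fejer_kernel N (x - y))
      <= \sum_(i < n) (N.+1%:R^-1 : R).
    by apply: ler_sum => i _; exact: mean_fejer_concentration.
  rewrite sumr_const card_ord => h; have {h} := ler_wpM2l K0 h.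
  have : K * (N.+1%:R^-1 *+ n) <= e / 2.
    rewrite -(mulr_natl _ n) mulrA ler_pdivrMr ?ltr0n // (mulrC (e / 2)) -ler_pdivrMr; last by lra.
    have := archi_boundP (x := K * n%:R / (e / 2)) _.
    rewrite divr_ge0 //; last by lra.
    move=> /(_ isT) /ltW /le_trans; apply.
    by rewrite ler_nat; apply: leq_trans NN _.
  move=> b h; apply: le_trans (lerD (lexx _) (le_trans h b)) _; lra.
apply: le_trans mB; rewrite ler_norml; apply/andP; split.
  rewrite -meanN //; apply: mean_le => // [|y]; first exact: torus_continuousN.
  by have /ler_normlP[] := HB y; rewrite lerNl.
by apply: mean_le => // y; have /ler_normlP[] := HB y.
Qed.

Lemma fejer_norm_le N f c x : torus_continuous f -> (forall y, `|f y| <= c) ->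
  `|fejer N f x| <= c.
Proof.
move=> fc fb; rewrite fejerE //.
have kc := torus_continuous_fejer_kernel N x.
have dc : torus_continuous (fun y => f y * fejer_kernel N (x - y)).
  exact: torus_continuousM.
have E : mean (fun y => c * fejer_kernel N (x - y)) = c.
  by rewrite meanZ // mean_fejer_kernel mulr1.
have HB y : `|f y * fejer_kernel N (x - y)| <= c * fejer_kernel N (x - y).
  by rewrite normrM (ger0_norm (fejer_kernel_ge0 _ _)) ler_wpM2r // fejer_kernel_ge0.
rewrite ler_norml -E -meanN ?E; last exact: torus_continuousZ.
apply/andP; split.
  apply: mean_le => // [|y]; first exact/torus_continuousN/torus_continuousZ.
  by have /ler_normlP[] := HB y; rewrite lerNl.
rewrite -E; apply: mean_le => // [|y]; first exact: torus_continuousZ.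
by have /ler_normlP[] := HB y.
Qed.

Lemma fejer_ge0 N f x : torus_continuous f -> (forall y, 0 <= f y) ->
  0 <= fejer N f x.
Proof.
move=> fc fb; rewrite fejerE //.
apply: mean_ge0 => [|y]; last by rewrite mulr_ge0 // fejer_kernel_ge0.
by apply: torus_continuousM => //; exact: torus_continuous_fejer_kernel.
Qed.

Lemma fejer_half_lap N g h x : half_lap g h ->
  fejer N h x = @fejer_weight R n N *
  \sum_(j : fejer_idx N) \sum_(l : fejer_idx N)
    freq_norm R (fejer_freq j - fejer_freq l) *
    wave (ccoef g (fejer_freq j - fejer_freq l))
      (scoef g (fejer_freq j - fejer_freq l)) (fejer_freq j - fejer_freq l) x.
Proof.
move=> [_ _ /half_laplacianP H]; congr (_ * _).
apply: eq_bigr => j _; apply: eq_bigr => l _; rewrite /wave.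
by have [-> ->] := H (fejer_freq j - fejer_freq l); ring.
Qed.

End FejerConvergence.

(** * A polynomial iteration for 1 - sqrt(1 - z) *)

Section SqrtIteration.
Context {R : realType}.

Lemma cvg_sumr (T J : Type) (F : set_system T) {FF : Filter F} (r : seq J)
    (f : J -> T -> R) (l : J -> R) : (forall i, f i x @[x --> F] --> l i) ->
  \sum_(i <- r) f i x @[x --> F] --> \sum_(i <- r) l i.
Proof.
move=> H; elim: r => [|i r IH].
  rewrite big_nil (_ : (fun x => _) = fun=> 0); first exact: cvg_cst.
  by apply/funext => x; rewrite big_nil.
rewrite big_cons (_ : (fun x => _) = fun x => f i x + \sum_(j <- r) f j x).
  exact: cvgD.
by apply/funext => x; rewrite big_cons.
Qed.

(** Only sums, products and nonnegative constants occur, so the same recursion can be run on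
    positive symbols. *)
Fixpoint sqrt_iter (z : R) (j : nat) : R :=
  if j is j'.+1 then 2^-1 * (z + sqrt_iter z j' ^+ 2) else 0.

Lemma sqrt_iter_bounds z j : 0 <= z <= 1 ->
  0 <= sqrt_iter z j <= 1 - Num.sqrt (1 - z).
Proof.
move=> /andP[z0 z1]; set r := Num.sqrt _.
have r2 : r ^+ 2 = 1 - z by rewrite /r sqr_sqrtr // subr_ge0.
have r0 : 0 <= r by exact: sqrtr_ge0.
elim: j => [|j /andP[h1 h2]] /=; first by rewrite lexx /=; nra.
by apply/andP; split; nra.
Qed.

Lemma sqrt_iter_nondec z : 0 <= z <= 1 -> nondecreasing_seq (sqrt_iter z).
Proof.
move=> z01; apply/nondecreasing_seqP; elim=> [|j IH] /=.
  by case/andP: z01 => z0 _; rewrite expr0n addr0; lra.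
have /andP[h1 _] := sqrt_iter_bounds j z01.
have : sqrt_iter z j ^+ 2 <= sqrt_iter z j.+1 ^+ 2 by rewrite lerXn2r ?nnegrE ?(le_trans h1).
by rewrite /=; lra.
Qed.

(** The limit l of this bounded monotone sequence solves l = (z + l^2) / 2, that is (1 - l)^2 = 1 -
    z; the bound l <= 1 selects the root. *)
Lemma sqrt_iter_cvg z : 0 <= z <= 1 ->
  sqrt_iter z j @[j --> \oo] --> 1 - Num.sqrt (1 - z).
Proof.
move=> z01; have bd j := sqrt_iter_bounds j z01.
have cv : cvgn (sqrt_iter z).
  apply: nondecreasing_is_cvgn; first exact: sqrt_iter_nondec.
  by exists (1 - Num.sqrt (1 - z)) => _ [j _ <-]; have /andP[] := bd j.
suff <- : limn (sqrt_iter z) = 1 - Num.sqrt (1 - z) by [].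
set l := limn _; case/andP: z01 => z0 z1.
have r2 : Num.sqrt (1 - z) ^+ 2 = 1 - z by rewrite sqr_sqrtr // subr_ge0.
have r0 : 0 <= Num.sqrt (1 - z) by exact: sqrtr_ge0.
have l1 : l <= 1 - Num.sqrt (1 - z).
  by apply: limr_le => //; apply: nearW => j; have /andP[] := bd j.
have lE : l = 2^-1 * (z + l ^+ 2).
  have c1 : sqrt_iter z j.+1 @[j --> \oo] --> l by rewrite cvg_shiftS.
  have c2 : sqrt_iter z j.+1 @[j --> \oo] --> 2^-1 * (z + l ^+ 2).
    apply: cvgM; first exact: cvg_cst.
    by apply: cvgD; [exact: cvg_cst|apply: cvgM].
  exact: etrans (esym (cvg_lim (@Rhausdorff R) c1)) (cvg_lim (@Rhausdorff R) c2).
have e1 : (1 - l) ^+ 2 = Num.sqrt (1 - z) ^+ 2 by rewrite r2; lra.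
have l0 : 0 <= 1 - l by lra.
have := congr1 Num.sqrt e1; rewrite !sqrtr_sqr !ger0_norm //; lra.
Qed.

End SqrtIteration.

(** * Minimum principle for trigonometric polynomials *)

Section MinimumPrinciple.
Context {R : realType} {n : nat} {I : finType}.
Variable k : I -> 'rV[int]_n.
Implicit Types (a b mu : I -> R) (x y : 'rV[R]_n).

Definition trig_poly a b x : R := \sum_i wave (a i) (b i) (k i) x.

(* [mu] is the symbol of a positive operator, of total mass [th], on the
   trigonometric polynomials with frequencies [k]. *)
Definition positive_symbol mu (th : R) := forall a b (m : R),
  (forall x, m <= trig_poly a b x) ->
  forall x, th * m <= trig_poly (fun i => mu i * a i) (fun i => mu i * b i) x.

Lemma positive_symbolM mu nu th ta :
  positive_symbol mu th -> positive_symbol nu ta ->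
  positive_symbol (fun i => mu i * nu i) (th * ta).
Proof.
move=> Hm Hn a b m H x; have := Hm _ _ _ (Hn _ _ _ H) x.
rewrite -mulrA; congr (_ <= trig_poly _ _ _); apply/funext => i;
  by rewrite mulrA.
Qed.

Lemma positive_symbol_lin (c d : R) mu nu th ta : 0 <= c -> 0 <= d ->
  positive_symbol mu th -> positive_symbol nu ta ->
  positive_symbol (fun i => c * mu i + d * nu i) (c * th + d * ta).
Proof.
move=> c0 d0 Hm Hn a b m H x.
have h1 := ler_wpM2l c0 (Hm _ _ _ H x); have h2 := ler_wpM2l d0 (Hn _ _ _ H x).
rewrite mulrDl -!mulrA (le_trans (lerD h1 h2)) // /trig_poly.
rewrite !mulr_sumr -big_split /= le_eqVlt; apply/orP; left; apply/eqP.
by apply: eq_bigr => i _; rewrite /wave; ring.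
Qed.

Lemma positive_symbol0 : positive_symbol (fun=> 0) 0.
Proof.
move=> a b m H x; rewrite mul0r /trig_poly big1 // => i _.
by rewrite /wave !mul0r addr0.
Qed.

(** By cos^2 t = (1 + cos 2t) / 2, the operator is half the identity plus a quarter of each
    translation by 2 eta and -2 eta along coordinate s. *)
Lemma positive_symbol_cos2 (eta : R) (s : 'I_n) :
  positive_symbol (fun i => cos (eta * (k i 0 s)%:~R) ^+ 2) 1.
Proof.
move=> a b m H x; rewrite mul1r.
have := H x; have := H (x + (2 * eta) *: delta_mx 0 s).
have := H (x + (- (2 * eta)) *: delta_mx 0 s).
suff -> : trig_poly (fun i => cos (eta * (k i 0 s)%:~R) ^+ 2 * a i)
    (fun i => cos (eta * (k i 0 s)%:~R) ^+ 2 * b i) x =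
  2^-1 * trig_poly a b x + 4^-1 * trig_poly a b (x + (2 * eta) *: delta_mx 0 s) +
  4^-1 * trig_poly a b (x + (- (2 * eta)) *: delta_mx 0 s) by lra.
rewrite /trig_poly !mulr_sumr -!big_split /=; apply: eq_bigr => i _.
rewrite /wave !freq_dotDr !freq_dotZr !freq_dot_delta mulNr.
have -> : 2 * eta * (k i 0 s)%:~R = (eta * (k i 0 s)%:~R) *+ 2.
  by rewrite mulr2n; ring.
have := cos_mulr2n (eta * (k i 0 s)%:~R).
move: (_ *+ 2) (cos (_ * _)) => u c uE; rewrite !cosD !sinD cosN sinN uE mulr2n.
by field.
Qed.

Lemma eq_positive_symbol mu nu th ta : mu =1 nu -> th = ta ->
  positive_symbol mu th -> positive_symbol nu ta.
Proof. by move=> /funext -> ->. Qed.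

Definition mean_cos2 (eta : R) (i : I) : R :=
  n%:R^-1 * \sum_(s < n) cos (eta * (k i 0 s)%:~R) ^+ 2.

Lemma positive_symbol_mean_cos2 eta : (0 < n)%N ->
  positive_symbol (mean_cos2 eta) 1.
Proof.
move=> n0.
have Hr (r : seq 'I_n) : positive_symbol
    (fun i => \sum_(s <- r) cos (eta * (k i 0 s)%:~R) ^+ 2) (size r)%:R.
  elim: r => [|s r IH].
    by apply: eq_positive_symbol positive_symbol0 => // i; rewrite big_nil.
  have := positive_symbol_lin ler01 ler01 (positive_symbol_cos2 eta s) IH.
  apply: eq_positive_symbol => [i|]; first by rewrite big_cons !mul1r.
  by rewrite /= !mul1r -natr1 addrC.
have i0 : 0 <= n%:R^-1 :> R by [].
have := positive_symbol_lin i0 (lexx 0) (Hr (index_enum 'I_n)) positive_symbol0.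
apply: eq_positive_symbol => [i|]; first by rewrite mulr0 addr0.
rewrite mulr0 addr0 /index_enum -enumT size_enum_ord mulVf //.
by rewrite pnatr_eq0 -lt0n.
Qed.

Lemma positive_symbol_sqrt_iter mu j : positive_symbol mu 1 ->
  positive_symbol (fun i => sqrt_iter (mu i) j) (sqrt_iter 1 j).
Proof.
move=> H; elim: j => [|j IH]; first exact: positive_symbol0.
have h0 : 0 <= 2^-1 :> R by [].
have := positive_symbol_lin h0 h0 H (positive_symbolM IH IH).
by apply: eq_positive_symbol => [i|] /=; rewrite expr2 mulrDr.
Qed.

(** The operators with symbols [sqrt_iter (mu i) j] have total mass tending to 1. In the limit the
    minimum value is at most sum_i (1 - sqrt(1 - mu_i)) c_i, while it equals sum_i c_i; the
    difference of the two sums is the claim. *)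
Lemma trig_poly_min_sqrt mu a b x0 : (forall i, 0 <= mu i <= 1) ->
  positive_symbol mu 1 -> (forall x, trig_poly a b x0 <= trig_poly a b x) ->
  \sum_i Num.sqrt (1 - mu i) * wave (a i) (b i) (k i) x0 <= 0.
Proof.
move=> m01 pm H; set c := fun i => wave (a i) (b i) (k i) x0.
have Hj j : sqrt_iter 1 j * trig_poly a b x0 - \sum_i sqrt_iter (mu i) j * c i <= 0.
  rewrite subr_le0 (le_trans (positive_symbol_sqrt_iter j pm H x0)) //.
  rewrite le_eqVlt; apply/orP; left; apply/eqP; apply: eq_bigr => i _.
  by rewrite /c /wave; ring.
have cv : sqrt_iter 1 j * trig_poly a b x0 - \sum_i sqrt_iter (mu i) j * c i
    @[j --> \oo] --> (1 - Num.sqrt (1 - 1)) * trig_poly a b x0 -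
      \sum_i (1 - Num.sqrt (1 - mu i)) * c i.
  apply: cvgB.
    by apply: cvgM; [apply: sqrt_iter_cvg; rewrite ler01 lexx|exact: cvg_cst].
  apply: cvg_sumr => i.
  by apply: cvgM; [exact: sqrt_iter_cvg|exact: cvg_cst].
have : (1 - Num.sqrt (1 - 1)) * trig_poly a b x0 -
      \sum_i (1 - Num.sqrt (1 - mu i)) * c i <= 0.
  rewrite -(cvg_lim (@Rhausdorff R) cv); apply: limr_le; last exact: nearW.
  by apply/cvg_ex; eexists; exact: cv.
rewrite subrr sqrtr0 subr0 mul1r /trig_poly -sumrB.
by congr (_ <= _); apply: eq_bigr => i _; rewrite /c; ring.
Qed.

Lemma trig_poly_min_principle a b x0 :
  (forall x, trig_poly a b x0 <= trig_poly a b x) ->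
  \sum_i freq_norm R (k i) * wave (a i) (b i) (k i) x0 <= 0.
Proof.
(* In dimension 0 every frequency has norm 0, and [mean_cos2] would average over no coordinates. *)
move=> H; have [n0|n0] := posnP n.
  rewrite big1 // => i _; rewrite /freq_norm big1 ?sqrtr0 ?mul0r // => s _.
  by have := ltn_ord s; rewrite [X in (_ < X)%N]n0.
set c := fun i => wave (a i) (b i) (k i) x0.
have nR : 0 < n%:R :> R by rewrite ltr0n.
have sin2 eta i : 1 - mean_cos2 eta i = n%:R^-1 * \sum_(s < n) sin (eta * (k i 0 s)%:~R) ^+ 2.
  rewrite /mean_cos2 -[X in X - _](mulVf (x := n%:R)) ?gt_eqF //.
  rewrite -mulrBr; congr (_ * _).
  rewrite -[X in X%:R](card_ord n) -sumr_const -sumrB.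
  by apply: eq_bigr => s _; rewrite sin2cos2.
have mc01 eta i : 0 <= mean_cos2 eta i <= 1.
  apply/andP; split.
    apply: mulr_ge0; first by rewrite invr_ge0 ltW.
    by apply: sumr_ge0 => s _; exact: sqr_ge0.
  rewrite -subr_ge0 sin2; apply: mulr_ge0; first by rewrite invr_ge0 ltW.
  by apply: sumr_ge0 => s _; exact: sqr_ge0.
have Hsin eta : \sum_i Num.sqrt (\sum_(s < n) sin (eta * (k i 0 s)%:~R) ^+ 2) * c i <= 0.
  have s0 : 0 < Num.sqrt (n%:R^-1 : R) by rewrite sqrtr_gt0 invr_gt0.
  rewrite -(pmulr_rle0 _ s0) mulr_sumr.
  have := trig_poly_min_sqrt (mc01 eta) (positive_symbol_mean_cos2 eta n0) H.
  congr (_ <= _).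
  apply: eq_bigr => i _; rewrite sin2 sqrtrM ?invr_ge0 ?ler0n //.
  by rewrite -mulrA.
(* Division by h makes the limit visible: sin(h k_s) / h tends to k_s, so that [F h] tends to the
   sum of the |k_i| c_i. *)
pose F (h : R) := \sum_i Num.sqrt (\sum_(s < n) (h^-1 * sin (h * (k i 0 s)%:~R)) ^+ 2) * c i.
have F0 h : F h <= 0.
  have -> : F h = `|h^-1| * \sum_i Num.sqrt (\sum_(s < n) sin (h * (k i 0 s)%:~R) ^+ 2) * c i.
    rewrite mulr_sumr; apply: eq_bigr => i _; rewrite mulrA; congr (_ * _).
    rewrite -sqrtr_sqr -sqrtrM ?sqr_ge0 // mulr_sumr; congr Num.sqrt.
    by apply: eq_bigr => s _; rewrite exprMn.
  by rewrite mulr_ge0_le0.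
(* This is the difference quotient at h = 0 of sin(h t). *)
have cs (t : R) : h^-1 * sin (h * t) @[h --> 0^'] --> t.
  have dF : is_derive (0 : R) (1 : R) (fun h : R => sin (h * t)) t.
    apply: is_derive_eq.
    by rewrite mul0r cos0 mul1r scaler0 add0r /GRing.scale /= mulr1.
  case: dF => dF dE; rewrite /derivable in dF.
  have := dF; rewrite /= => {}dF.
  have E : (fun h : R => h^-1 * sin (h * t)) =
      (fun h : R => h^-1 *: (sin ((h *: (1 : R) + 0) * t) - sin (0 * t))).
    by apply/funext => h; rewrite mul0r sin0 subr0 addr0 /GRing.scale /= mulr1.
  by rewrite E -[X in _ --> X]dE.
have cF : F h @[h --> 0^'] --> \sum_i freq_norm R (k i) * c i.
  apply: cvg_sumr => i; apply: cvgM; last exact: cvg_cst.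
  apply: continuous_cvg; first exact: sqrt_continuous.
  by apply: cvg_sumr => s; apply: cvgM; exact: cs.
rewrite -(cvg_lim (@Rhausdorff R) cF); apply: limr_le; last exact: nearW.
by apply/cvg_ex; eexists; exact: cF.
Qed.

End MinimumPrinciple.

(** * Positivity and contractivity of the resolvents *)

Section Resolvent.
Context {R : realType} {n : nat}.
Implicit Types (f g h u v : 'rV[R]_n -> R) (k l : 'rV[int]_n) (x y z : 'rV[R]_n).

Lemma fejer_lin N c f g x : torus_continuous f -> torus_continuous g ->
  fejer N (fun y => c * f y + g y) x = c * fejer N f x + fejer N g x.
Proof.
move=> fc gc; have kc := torus_continuous_fejer_kernel N x.
have lc : torus_continuous (fun y => c * f y + g y).
  by apply: torus_continuousD => //; exact: torus_continuousZ.
rewrite !fejerE // -mean_lin; [|exact: torus_continuousM..].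
by congr mean; apply/funext => y; ring.
Qed.

Lemma torus_continuous_fejer N f : torus_continuous (fejer N f).
Proof.
pose k (j l : fejer_idx N) : 'rV[int]_n := fejer_freq j - fejer_freq l.
have W (j l : fejer_idx N) : torus_continuous (wave (ccoef f (k j l)) (scoef f (k j l)) (k j l)).
  by have [] := half_lap_wave (ccoef f (k j l)) (scoef f (k j l)) (k j l).
have S := torus_continuous_sum (index_enum (fejer_idx N))
  (fun j => torus_continuous_sum (index_enum (fejer_idx N)) (W j)).
have Z := torus_continuousZ (@fejer_weight R n N) S.
exact: Z.
Qed.

(** The Fejer mean of h is obtained from that of g by applying |k| termwise. The pairs (j, l) index
    the terms; repeated frequencies are allowed in [trig_poly]. *)
Lemma fejer_min_principle N g h x0 : half_lap g h ->
  (forall x, fejer N g x0 <= fejer N g x) -> fejer N h x0 <= 0.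
Proof.
move=> H gmin; rewrite (fejer_half_lap _ _ H).
rewrite pmulr_rle0 ?fejer_weight_gt0 //.
pose k (p : fejer_idx N * fejer_idx N) : 'rV[int]_n := fejer_freq p.1 - fejer_freq p.2.
rewrite pair_big /=.
apply: (trig_poly_min_principle (k := k) (a := fun p => ccoef g (k p))
  (b := fun p => scoef g (k p))) => x.
have := gmin x; rewrite /fejer ler_pM2l ?fejer_weight_gt0 //.
by rewrite !pair_big.
Qed.

(** At a minimum x0 of a Fejer mean of g, the Fejer mean of h is at most 0 while that of g + e h is
    at least 0. So the Fejer means of g are nonnegative, and so is their limit. *)
Lemma half_lap_resolvent_ge0 g h (e : R) : half_lap g h -> 0 < e ->
  (forall x, 0 <= g x + e * h x) -> forall x, 0 <= g x.
Proof.
move=> H e0 gh x; have [gc hc _] := H.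
have fg N : 0 <= fejer N g x.
  have [x0 m0] := torus_min (torus_continuous_fejer N g).
  apply: le_trans (m0 x).
  have h0 := fejer_min_principle H m0.
  have : 0 <= fejer N (fun y => e * h y + g y) x0.
    apply: fejer_ge0 => [|y]; last by rewrite addrC.
    by apply: torus_continuousD => //; exact: torus_continuousZ.
  rewrite fejer_lin //; nra.
rewrite leNgt; apply/negP => gx.
have [|N0 HN] := @fejer_approx R n g (- g x / 2) gc; first by lra.
have := HN N0 (leqnn _) x; have := fg N0; rewrite ler_norml => ? /andP[]; lra.
Qed.

Lemma half_lap_resolvent_le g h (e b : R) : half_lap g h -> 0 < e ->
  (forall x, g x + e * h x <= b) -> forall x, g x <= b.
Proof.
move=> H e0 gh x; rewrite -subr_ge0.
have := half_lap_resolvent_ge0 (half_lapB (half_lap_cst b) H) e0.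
by apply=> y; have := gh y; lra.
Qed.

Lemma half_lap_resolvent_norm g h (e b : R) : half_lap g h -> 0 < e ->
  (forall x, `|g x + e * h x| <= b) -> forall x, `|g x| <= b.
Proof.
move=> H e0 gh x; rewrite ler_norml; apply/andP; split.
  rewrite lerNl -mulN1r.
  apply: (half_lap_resolvent_le (half_lapZ (-1) H) e0) => y.
  by have := gh y; rewrite ler_norml => /andP[]; lra.
apply: (half_lap_resolvent_le H e0) => y.
by have := gh y; rewrite ler_norml => /andP[].
Qed.

End Resolvent.

(** * Mean value theorem and Lipschitz bounds for sine and cosine *)

Section MeanValue.
Context {R : realType}.

Lemma mean_value (f f' : R -> R) : (forall x, is_derive x (1 : R) f (f' x)) ->
  forall a b, exists2 c, `|c - a| <= `|b - a| & f b - f a = f' c * (b - a).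
Proof.
move=> df.
have cf : continuous f.
  by move=> t; apply/differentiable_continuous/derivable1_diffP; have [] := df t.
have lt_case a b : a < b -> exists2 c, c \in `]a, b[ & f b - f a = f' c * (b - a).
  by move=> ab; apply: MVT => // ; exact: continuous_subspaceT.
move=> a b; have [ab|ba|->] := ltgtP a b.
- have [c] := lt_case _ _ ab; rewrite in_itv /= => /andP[ac cb] E; exists c => //.
  by rewrite !gtr0_norm ?subr_gt0 //; lra.
- have [c] := lt_case _ _ ba; rewrite in_itv /= => /andP[ac cb] E; exists c.
    by rewrite !ltr0_norm ?subr_lt0 //; lra.
  by rewrite -opprB E; ring.
- by exists b => //; rewrite !subrr mulr0.
Qed.

Lemma cos_lipschitz (s t : R) : `|cos s - cos t| <= `|s - t|.
Proof.
have [c _ ->] := mean_value (fun x => is_derive_cos x) t s.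
rewrite normrM normrN -[leRHS]mul1r ler_wpM2r //; exact: sin_max.
Qed.

Lemma sin_lipschitz (s t : R) : `|sin s - sin t| <= `|s - t|.
Proof.
have [c _ ->] := mean_value (fun x => is_derive_sin x) t s.
rewrite normrM -[leRHS]mul1r ler_wpM2r //; exact: cos_max.
Qed.

End MeanValue.

(** * Uniform bounds for sums of (1 + e |k|)^-2 over integers *)

Section LatticeSum.
Context {R : realType}.
Variables (e : R).
Hypothesis e0 : 0 < e.

(* The derivative of [F] is [(1 + e) / (1 + e |t|)^2], so that the increments of
   [F] along the integers majorize the lattice sum on both sides of 0. *)
Let F (t : R) := (1 + e) * t / (1 + e * `|t|).

Lemma one_add_gt0 (t : R) : 0 < 1 + e * `|t|.
Proof. by rewrite ltr_pwDl // mulr_ge0 // ltW. Qed.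

(** In both ranges the increment is (1 + e) / ((1 + e |t|) (1 + e |t + 1|)), and 1 + e |t + 1| <= (1
    + e) (1 + e |t|). Integer t never fall in the excluded range, where the interval from t to t + 1
    crosses 0. *)
Lemma telescope_bound (t : R) : 0 <= t \/ t <= -1 ->
  (1 + e * `|t|) ^- 2 <= F (t + 1) - F t.
Proof.
have p1 := one_add_gt0 t; have p2 := one_add_gt0 (t + 1).
have h : (1 + e * `|t|) ^+ 2 * (F (t + 1) - F t) * (1 + e * `|t + 1|) =
   (1 + e * `|t|) * (1 + e) * ((t + 1) * (1 + e * `|t|) - t * (1 + e * `|t + 1|)).
  rewrite /F; field; by rewrite !gt_eqF.
move=> tt; rewrite -[leLHS]mul1r ler_pdivrMr ?exprn_gt0 // mulrC.
rewrite -(ler_pM2r p2) mul1r h.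
case: tt => tt.
  have -> : `|t| = t by rewrite ger0_norm.
  have -> : `|t + 1| = t + 1 by apply: ger0_norm; lra.
  have et : 0 <= e * t by rewrite mulr_ge0 // ltW.
  have eet : 0 <= e * (e * t) by rewrite !mulr_ge0 // ltW.
  rewrite (_ : (t + 1) * _ - _ = 1); last by ring.
  by lra.
have -> : `|t| = - t by apply: ler0_norm; lra.
have -> : `|t + 1| = - (t + 1) by apply: ler0_norm; lra.
rewrite (_ : (t + 1) * _ - _ = 1); last by ring.
have et : 0 <= e * (- t - 1) by apply: mulr_ge0; [exact: ltW|lra].
have eet : 0 <= e * (e * - t) by do 2 (apply: mulr_ge0; first exact: ltW); lra.
have e1 := ltW e0.
by lra.
Qed.

Lemma telescope_norm_le t : `|F t| <= (1 + e) / e.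
Proof.
have e1 := e0; rewrite /F !normrM normfV (gtr0_norm (one_add_gt0 t)) gtr0_norm; last by lra.
rewrite ler_pdivrMr ?one_add_gt0 // mulrDr mulr1 mulrA divfK ?gt_eqF //.
by rewrite lerDr; apply: divr_ge0; lra.
Qed.

(** The majorant telescopes to [F (N - j) - F (- j)], which is bounded independently of N and j. *)
Lemma lattice_sum1 (N : nat) (j : nat) :
  \sum_(c < N) (1 + e * `|(j%:Z - c%:Z)%:~R|) ^- 2 <= 2 * ((1 + e) / e).
Proof.
apply: (@le_trans _ _ (\sum_(c < N) (F (c.+1%:R - j%:R) - F (c%:R - j%:R)))).
  apply: ler_sum => c _; have -> : c.+1%:R - j%:R = c%:R - j%:R + 1 :> R.
    by rewrite -natr1; ring.
  have -> : `|(j%:Z - c%:Z)%:~R| = `|c%:R - j%:R : R|.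
    by rewrite intrB -!pmulrn distrC.
  apply: telescope_bound; have [cj|jc] := ltnP c j.
    right; rewrite lerBlDr addrC lerBrDr natr1 ler_nat //.
  by left; rewrite subr_ge0 ler_nat.
rewrite -(big_mkord xpredT (fun c => F (c.+1%:R - j%:R) - F (c%:R - j%:R))).
rewrite telescope_sumr //.
have := telescope_norm_le (N%:R - j%:R); have := telescope_norm_le (0%:R - j%:R).
rewrite !ler_norml => /andP[a b] /andP[c d]; lra.
Qed.

End LatticeSum.

(** * Smoothing by powers of the resolvent, and the modulus of continuity *)

Section FejerMultiplier.
Context {R : realType} {n : nat}.
Implicit Types (f g h u v : 'rV[R]_n -> R) (k l : 'rV[int]_n) (x y z : 'rV[R]_n).
Implicit Types (m : 'rV[int]_n -> R).

(** The Fejer mean of the multiplier with symbol m applied to f. The sum is finite, so m may be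
    unbounded. *)
Definition fejer_mult (N : nat) m f x : R := @fejer_weight R n N *
  \sum_(j : fejer_idx N) \sum_(l : fejer_idx N)
    m (fejer_freq j - fejer_freq l) *
    wave (ccoef f (fejer_freq j - fejer_freq l))
      (scoef f (fejer_freq j - fejer_freq l)) (fejer_freq j - fejer_freq l) x.

Lemma fejer_mult1 N f : fejer N f = fejer_mult N (fun=> 1) f.
Proof.
apply/funext => x; congr (_ * _).
by apply: eq_bigr => j _; apply: eq_bigr => l _; rewrite mul1r.
Qed.

Lemma fejer_mult_lin N c m m' f x :
  fejer_mult N (fun k => c * m k + m' k) f x =
  c * fejer_mult N m f x + fejer_mult N m' f x.
Proof.
rewrite /fejer_mult mulrCA -mulrDr; congr (_ * _); rewrite mulr_sumr -big_split.
apply: eq_bigr => j _ /=; rewrite mulr_sumr -big_split; apply: eq_bigr => l _ /=.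
by rewrite mulrDl mulrA.
Qed.

Lemma half_lap_fejer_mult N m f :
  half_lap (fejer_mult N m f) (fejer_mult N (fun k => freq_norm R k * m k) f).
Proof.
pose k (j l : fejer_idx N) : 'rV[int]_n := fejer_freq j - fejer_freq l.
have W (j l : fejer_idx N) := half_lapZ (m (k j l))
  (half_lap_wave (ccoef f (k j l)) (scoef f (k j l)) (k j l)).
have S := half_lap_sum (index_enum _) (fun j => half_lap_sum (index_enum _) (W j)).
have := half_lapZ (@fejer_weight R n N) S.
congr half_lap; apply/funext => x; congr (_ * _).
by apply: eq_bigr => j _; apply: eq_bigr => l _; rewrite -mulrA mulrCA.
Qed.

Lemma fejer_mult_half_lap N m g h x : half_lap g h ->
  fejer_mult N m h x = fejer_mult N (fun k => freq_norm R k * m k) g x.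
Proof.
move=> [_ _ /half_laplacianP H]; congr (_ * _).
apply: eq_bigr => j _; apply: eq_bigr => l _; rewrite /wave.
by have [-> ->] := H (fejer_freq j - fejer_freq l); ring.
Qed.

Definition resolvent_symbol (e : R) k : R := (1 + e * freq_norm R k)^-1.

Lemma resolvent_den_gt0 e k : 0 < e -> 0 < 1 + e * freq_norm R k.
Proof. by move=> e0; rewrite ltr_pwDl // mulr_ge0 ?freq_norm_ge0 // ltW. Qed.

(** With r the symbol of (1 + e A)^-1, this is (1 + e |k|) r^(s+1) = r^s. *)
Lemma fejer_resolvent_step N e s f x : 0 < e ->
  fejer_mult N (fun k => resolvent_symbol e k ^+ s.+1) f x +
  e * fejer_mult N (fun k => freq_norm R k * resolvent_symbol e k ^+ s.+1) f x =
  fejer_mult N (fun k => resolvent_symbol e k ^+ s) f x.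
Proof.
move=> e0; rewrite addrC -fejer_mult_lin; congr (fejer_mult _ _ _ _).
apply/funext => k; have p := resolvent_den_gt0 k e0.
rewrite exprS mulrA mulrA -mulrDl -[in RHS](mul1r (_ ^+ s)); congr (_ * _).
by rewrite /resolvent_symbol; field; rewrite gt_eqF.
Qed.

(** Consecutive powers applied to g differ by e (1 + e A)^-(s+1) h, which contractivity bounds by e
    b; s such differences are added. *)
Lemma fejer_resolvent_bound N e (b : R) s g h x : 0 < e -> half_lap g h ->
  (forall x, `|h x| <= b) ->
  `|fejer N g x - fejer_mult N (fun k => resolvent_symbol e k ^+ s) g x|
    <= s%:R * (e * b).
Proof.
move=> e0 H hb; have [_ hc _] := H.
have Hh t : forall x, `|fejer_mult N (fun k => resolvent_symbol e k ^+ t) h x| <= b.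
  elim: t => [|t IH] y.
    rewrite (_ : (fun k => _) = fun=> 1); last by apply/funext => k; rewrite expr0.
    by rewrite -fejer_mult1; exact: fejer_norm_le.
  apply: (half_lap_resolvent_norm (half_lap_fejer_mult N _ h) e0) => z.
  by rewrite fejer_resolvent_step.
elim: s => [|s IH].
  rewrite (_ : (fun k => _) = fun=> 1); last by apply/funext => k; rewrite expr0.
  by rewrite -fejer_mult1 subrr normr0 mul0r.
have := fejer_resolvent_step N s g x e0.
rewrite -(fejer_mult_half_lap _ _ _ H) => E.
have := Hh s.+1 x; set T := fejer_mult N _ h x in E *.
rewrite -natr1 mulrDl mul1r => Tb.
rewrite -E opprD addrA in IH.
have -> : forall a c : R, a - c = a - c - e * T + e * T by move=> *; ring.
apply: le_trans (ler_normD _ _) _; rewrite lerD //.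
by rewrite normrM gtr0_norm // ler_pM2l.
Qed.

(** Since |k_i| <= |k|, the power 2 n of the symbol is at most the product over i of (1 + e
    |k_i|)^-2, and the sum factors into n one-dimensional ones. *)
Lemma fejer_lattice_sum N e : 0 < e ->
  @fejer_weight R n N * \sum_(j : fejer_idx N) \sum_(l : fejer_idx N)
    resolvent_symbol e (fejer_freq j - fejer_freq l) ^+ (2 * n) <=
  (2 * ((1 + e) / e)) ^+ n.
Proof.
move=> e0; have w0 := fejer_prod_gt0 (R := R) (n := n) N.
rewrite ler_pdivrMl //.
have <- : \sum_(j : @fejer_idx n N) (2 * ((1 + e) / e)) ^+ n =
    \prod_(i < n) N.+1%:R * (2 * ((1 + e) / e)) ^+ n.
  rewrite sumr_const card_ffun !card_ord -[LHS]mulr_natl prodr_const card_ord.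
  by rewrite natrX.
apply: ler_sum => j _.
pose G (i : 'I_n) (c : 'I_N.+1) : R := (1 + e * `|((j i : nat)%:Z - (c : nat)%:Z)%:~R|) ^- 2.
apply: (@le_trans _ _ (\sum_(l : fejer_idx N) \prod_i G i (l i))).
  apply: ler_sum => l _; set k := _ - _.
  rewrite exprM -[X in _ ^+ X](card_ord n) -prodr_const.
  apply: ler_prod => i _; rewrite /G /resolvent_symbol.
  have p1 := resolvent_den_gt0 k e0.
  rewrite exprVn invr_ge0 ltW ?exprn_gt0 //=.
  rewrite lef_pV2 ?posrE ?exprn_gt0 //; last exact: one_add_gt0.
  rewrite lerXn2r ?nnegrE //; [exact/ltW/one_add_gt0|exact: ltW|].
  rewrite lerD2l ler_pM2l //.
  by have := freq_coord_le (R := R) k i; rewrite !mxE.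
rewrite sum_fejer_idx -[X in _ ^+ X](card_ord n) -prodr_const.
apply: ler_prod => i _; rewrite lattice_sum1 // andbT.
by apply: sumr_ge0 => c _; rewrite invr_ge0 exprn_ge0 // ltW // one_add_gt0.
Qed.

Lemma wave_bound a b k x kap : `|a| <= kap -> `|b| <= kap ->
  `|wave a b k x| <= 2 * kap.
Proof.
move=> ha hb; rewrite /wave (le_trans (ler_normD _ _)) // !normrM.
have := cos_max (freq_dot k x); have := sin_max (freq_dot k x).
have := normr_ge0 a; have := normr_ge0 b.
have := normr_ge0 (cos (freq_dot k x)); have := normr_ge0 (sin (freq_dot k x)).
nra.
Qed.

Lemma wave_lipschitz a b k x y kap : `|a| <= kap -> `|b| <= kap ->
  `|wave a b k x - wave a b k y| <= 2 * kap * (n%:R * freq_norm R k * `|x - y|).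
Proof.
move=> ha hb; rewrite /wave.
have -> : a * cos (freq_dot k x) + b * sin (freq_dot k x) -
    (a * cos (freq_dot k y) + b * sin (freq_dot k y)) =
    a * (cos (freq_dot k x) - cos (freq_dot k y)) +
    b * (sin (freq_dot k x) - sin (freq_dot k y)) by ring.
rewrite (le_trans (ler_normD _ _)) // !normrM.
have L : `|freq_dot k x - freq_dot k y| <= n%:R * freq_norm R k * `|x - y|.
  apply: le_trans (freq_dot_lipschitz k x y) _; apply: ler_wpM2r => //.
  apply: (@le_trans _ _ (\sum_(i < n) freq_norm R k)).
    by apply: ler_sum => i _; exact: freq_coord_le.
  by rewrite sumr_const card_ord mulr_natl.
have Lc := le_trans (cos_lipschitz (freq_dot k x) (freq_dot k y)) L.
have Ls := le_trans (sin_lipschitz (freq_dot k x) (freq_dot k y)) L.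
have h1 := ler_pM (normr_ge0 _) (normr_ge0 _) ha Lc.
have h2 := ler_pM (normr_ge0 _) (normr_ge0 _) hb Ls.
by apply: le_trans (lerD h1 h2) _; lra.
Qed.

(** The first 2 n factors of the symbol make the sum over frequencies bounded. The last one absorbs
    the factor |k| in the Lipschitz constant of a wave, since |k| / (1 + e |k|) <= 1 / e. *)
Lemma fejer_mult_bound N e kap f x y : 0 < e ->
  (forall k, `|ccoef f k| <= kap /\ `|scoef f k| <= kap) ->
  let T := fejer_mult N (fun k => resolvent_symbol e k ^+ (2 * n).+1) f in
  `|T x| <= (2 * ((1 + e) / e)) ^+ n * (2 * kap) /\
  `|T x - T y| <= (2 * ((1 + e) / e)) ^+ n * (2 * kap * (n%:R / e * `|x - y|)).
Proof.
move=> e0 fk T; have w0 := fejer_weight_gt0 (R := R) (n := n) N.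
have kap0 : 0 <= kap by have [/(le_trans (normr_ge0 _))] := fk 0.
have S (q : 'rV[int]_n -> R) c : 0 <= c ->
    (forall k, `|q k| <= resolvent_symbol e k ^+ (2 * n) * c) ->
    `|@fejer_weight R n N * \sum_(j : fejer_idx N) \sum_(l : fejer_idx N)
      q (fejer_freq j - fejer_freq l)| <= (2 * ((1 + e) / e)) ^+ n * c.
  move=> c0 qb; have := ler_wpM2r c0 (fejer_lattice_sum N e0).
  apply: le_trans; rewrite normrM gtr0_norm // -mulrA ler_pM2l //.
  rewrite mulr_suml; apply: le_trans (ler_norm_sum _ _ _) _; apply: ler_sum => j _.
  by rewrite mulr_suml; apply: le_trans (ler_norm_sum _ _ _) _; apply: ler_sum.
have r0 k : 0 < resolvent_symbol e k by rewrite invr_gt0 resolvent_den_gt0.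
have r1 k : resolvent_symbol e k <= 1.
  rewrite /resolvent_symbol invf_le1 ?resolvent_den_gt0 // lerDl mulr_ge0 //.
    exact: ltW.
  exact: freq_norm_ge0.
have rk k : resolvent_symbol e k * freq_norm R k <= e^-1.
  rewrite /resolvent_symbol ler_pdivrMl ?resolvent_den_gt0 // mulrDl mul1r.
  by rewrite mulrAC mulfV ?gt_eqF // mul1r lerDr invr_ge0 ltW.
split.
  apply: (S (fun k => resolvent_symbol e k ^+ (2 * n).+1 *
    wave (ccoef f k) (scoef f k) k x)) => [|k]; first by rewrite mulr_ge0.
  have [hc hs] := fk k.
  rewrite normrM gtr0_norm ?exprn_gt0 //; apply: ler_pM => //; last exact: wave_bound.
    exact/ltW/exprn_gt0.
  by rewrite exprSr ler_piMr // exprn_ge0 // ltW.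
have -> : T x - T y = @fejer_weight R n N *
    \sum_(j : fejer_idx N) \sum_(l : fejer_idx N)
    (fun k => resolvent_symbol e k ^+ (2 * n).+1 *
       (wave (ccoef f k) (scoef f k) k x - wave (ccoef f k) (scoef f k) k y))
    (fejer_freq j - fejer_freq l).
  rewrite /T /fejer_mult -mulrBr -sumrB; congr (_ * _); apply: eq_bigr => j _.
  by rewrite -sumrB; apply: eq_bigr => l _; rewrite mulrBr.
apply: (S (fun k => resolvent_symbol e k ^+ (2 * n).+1 *
  (wave (ccoef f k) (scoef f k) k x - wave (ccoef f k) (scoef f k) k y))) => [|k].
  by rewrite !mulr_ge0 // invr_ge0 ltW.
have [hc hs] := fk k.
rewrite normrM gtr0_norm ?exprn_gt0 // exprSr -[leLHS]mulrA ler_pM2l ?exprn_gt0 //.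
apply: le_trans (ler_wpM2l (ltW (r0 k)) (wave_lipschitz k x y hc hs)) _.
rewrite mulrCA ler_wpM2l ?mulr_ge0 // mulrA ler_wpM2r // mulrCA ler_wpM2l //.
Qed.

(** g is split into a smoothed part, bounded and Lipschitz in terms of its Fourier coefficients, and
    a remainder that is small against the bound on A g. The constant C depends on e and the
    dimension only. *)
Lemma half_lap_modulus (e : R) : 0 < e -> exists2 C, 0 <= C &
  forall g h b kap, half_lap g h -> (forall x, `|h x| <= b) ->
  (forall k, `|ccoef g k| <= kap /\ `|scoef g k| <= kap) ->
  forall x, `|g x| <= e * b + C * kap /\
    forall y, `|g x - g y| <= e * b + C * kap * `|x - y|.
Proof.
(* With this d, the 2 n + 1 smoothing steps cost e b / 4; a difference g x - g y pays this twice. *)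
move=> e0; pose d : R := e / (4 * (2 * n).+1%:R).
have d0 : 0 < d by rewrite divr_gt0 // mulr_gt0 // ltr0n.
pose D : R := (2 * ((1 + d) / d)) ^+ n.
have D0 : 0 <= D.
  by rewrite exprn_ge0 // mulr_ge0 // divr_ge0 // ?addr_ge0 // ltW.
have nd0 : 0 <= n%:R / d by rewrite divr_ge0 // ltW.
exists (D * 2 * (1 + n%:R / d)) => [|g h b kap H hb gk x].
  by rewrite !mulr_ge0 // addr_ge0.
have b0 : 0 <= b by have := hb x; have := normr_ge0 (h x); lra.
have kap0 : 0 <= kap by have [/(le_trans (normr_ge0 _))] := gk 0.
have [gc _ _] := H.
have key N y : [/\ `|fejer N g x| <= e / 4 * b + D * (2 * kap) &
    `|fejer N g x - fejer N g y| <= e / 2 * b + D * (2 * kap * (n%:R / d * `|x - y|))].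
  have [T1 T2] := fejer_mult_bound N x y d0 gk.
  have E : (2 * n).+1%:R * (d * b) = e / 4 * b.
    have : (2 * n).+1%:R != 0 :> R by rewrite pnatr_eq0.
    by rewrite /d; move: (_.+1%:R) => q q0; field.
  have := fejer_resolvent_bound N (2 * n).+1 x d0 H hb.
  have := fejer_resolvent_bound N (2 * n).+1 y d0 H hb.
  move: T1 T2; rewrite /= -/D E.
  move: (fejer N g x) (fejer N g y) (fejer_mult _ _ _ x) (fejer_mult _ _ _ y).
  move: (D * _) (D * _) => A B p q r s.
  rewrite !ler_norml => /andP[? ?] /andP[? ?] /andP[? ?] /andP[? ?].
  by split; apply/andP; split; lra.
have approx : forall t, 0 < t -> exists N, forall y, `|fejer N g y - g y| <= t.
  move=> t t0; have [N0 HN] := fejer_approx gc t0.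
  by exists N0 => y; exact: HN.
have DK : 0 <= D * kap by rewrite mulr_ge0.
split=> [|y].
  rewrite leNgt; apply/negP => gt.
  (* Half of the excess over the claimed bound; a Fejer mean within t of g then gives a
     contradiction. *)
  pose t := (`|g x| - (e * b + D * 2 * (1 + n%:R / d) * kap)) / 2.
  have t0 : 0 < t by rewrite /t; lra.
  have [N HN] := approx _ t0; have [K1 _] := key N x.
  have := HN x; rewrite distrC => Hx.
  have : `|g x| <= t + (e / 4 * b + D * (2 * kap)).
    by rewrite -(subrK (fejer N g x) (g x)) (le_trans (ler_normD _ _)) // lerD.
  have : 0 <= e * b by rewrite mulr_ge0 // ltW.
  have : 0 <= D * kap * (n%:R / d) by rewrite mulr_ge0.
  by rewrite /t; lra.
rewrite leNgt; apply/negP => gt.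
pose t := (`|g x - g y| - (e * b + D * 2 * (1 + n%:R / d) * kap * `|x - y|)) / 4.
have t0 : 0 < t by rewrite /t; lra.
have [N HN] := approx _ t0; have [_ K2] := key N y.
have := HN x; have := HN y; rewrite (distrC _ (g x)) => Hy Hx.
have : `|g x - g y| <= t + t + (e / 2 * b + D * (2 * kap * (n%:R / d * `|x - y|))).
  have -> : g x - g y = (g x - fejer N g x) + (fejer N g y - g y) +
    (fejer N g x - fejer N g y) by ring.
  by rewrite (le_trans (ler_normD _ _)) // lerD // (le_trans (ler_normD _ _)) // lerD.
have : 0 <= e * b by rewrite mulr_ge0 // ltW.
have : 0 <= D * kap * `|x - y| by rewrite mulr_ge0.
have : 0 <= t by exact: ltW.
by rewrite /t; lra.
Qed.

End FejerMultiplier.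

(** * Compactness and passage to the limit *)

Section Closure.
Context {R : realType} {n : nat}.
Implicit Types (f g h u v : 'rV[R]_n -> R) (k l : 'rV[int]_n) (x y z : 'rV[R]_n).

Lemma le0_small (a c : R) : 0 <= c -> (forall t, 0 < t -> a <= c * t) -> a <= 0.
Proof.
move=> c0 H; rewrite leNgt; apply/negP => a0.
have := H (a / (2 * (c + 1))); rewrite divr_gt0 //; last by lra.
move=> /(_ isT); rewrite mulrA ler_pdivlMr; last by lra.
nra.
Qed.

Lemma coef_dist f g k c : torus_continuous f -> torus_continuous g ->
  (forall x, `|f x - g x| <= c) ->
  `|ccoef f k - ccoef g k| <= c /\ `|scoef f k - scoef g k| <= c.
Proof.
move=> fc gc H.
have [||h1 h2] := @coef_bound R n (fun x => -1 * g x + f x) k c.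
- by apply: torus_continuousD => //; exact: torus_continuousZ.
- by move=> x; have := H x; rewrite mulN1r addrC.
- by move: h1 h2; rewrite ccoef_lin // scoef_lin // !mulN1r ![- _ + _]addrC.
Qed.

(** Arzela-Ascoli along an ultrafilter U finer than [\oo]: pointwise limits exist by compactness of
    [-B, B], they inherit the equicontinuity, and compactness of the box makes the approximation
    uniform. *)
Lemma equicontinuous_ultra_limit (G : nat -> 'rV[R]_n -> R) (B : R) :
  (forall j, torus_periodic (G j)) -> (forall j x, `|G j x| <= B) ->
  (forall t, 0 < t -> exists2 d, 0 < d &
    forall j x y, `|x - y| < d -> `|G j x - G j y| <= t) ->
  exists2 g, torus_continuous g & forall t, 0 < t -> forall N : nat,
    exists2 j, (N <= j)%N & forall x, `|G j x - g x| <= t.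
Proof.
move=> Gp GB Geq.
have [U [UU sU]] := @ultraFilterLemma nat \oo _.
have FU : ProperFilter U := @ultra_proper _ _ UU.
have ptw x : exists p : R, forall t, 0 < t -> U [set j | `|G j x - p| <= t].
  have FF : ProperFilter (G^~ x @ U) by exact: fmap_proper_filter.
  have [|p [_ clp]] := @segment_compact R (- B) B (G^~ x @ U) FF.
    change (U (fun j => `[- B, B]%classic (G j x))).
    by apply: filterE => j; rewrite /= in_itv /= -ler_norml; exact: GB.
  (* A cluster point along an ultrafilter is a limit: otherwise U contains the complement of a
     neighbourhood of p. *)
  exists p => t t0; have [//|UA] := in_ultra_setVsetC [set j | `|G j x - p| <= t] UU.
  have [] := clp [set y | ~ `|y - p| <= t] (ball p t) UA (nbhsx_ballx _ _ t0).
  by move=> y []; rewrite -ball_normE /= => h1 h2; exfalso; apply: h1; rewrite distrC ltW.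
have [g Hg] := choice ptw.
have gdist x y c : (forall j, `|G j x - G j y| <= c) -> `|g x - g y| <= c.
  move=> H; rewrite -subr_le0; apply: (@le0_small _ 2) => // t t0.
  have [j [h1 h2]] := filter_ex (filterI (Hg x t t0) (Hg y t t0)).
  rewrite lerBlDl.
  have -> : g x - g y = (G j x - G j y) + (- (G j x - g x) + (G j y - g y)) by ring.
  apply: le_trans (ler_normD _ _) _; rewrite lerD //.
  by apply: le_trans (ler_normD _ _) _; rewrite normrN; move: h1 h2 => /=; lra.
have gp : torus_periodic g.
  move=> i x; apply/eqP; rewrite -subr_eq0 -normr_le0; apply: gdist => j.
  by rewrite Gp subrr normr0.
have gc : continuous g.
  apply/continuous_epsP => x e e0; have [d d0 Hd] := Geq e e0.
  by exists d => // y xy; apply: gdist => j; exact: Hd.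
exists g => // t t0 N.
have t30 : 0 < t / 3 by lra.
have [d d0 Hd] := Geq _ t30.
have near_x x : \near x & U, (fun j y => `|G j y - g y| <= t) U x.
  exists (ball x d, [set j | `|G j x - g x| <= t / 3]).
    by split; [exact: nbhsx_ballx|exact: Hg].
  move=> [y j] /= []; rewrite -ball_normE /= => xy h1.
  have h2 := Hd j _ _ xy.
  have h3 : `|g x - g y| <= t / 3 by apply: gdist => i; exact: Hd.
  have -> : G j y - g y = - (G j x - G j y) + (G j x - g x) + (g x - g y) by ring.
  apply: le_trans (ler_normD _ _) _.
  by have := ler_normD (- (G j x - G j y)) (G j x - g x); rewrite normrN; lra.
have := iffLR (compact_near_coveringP _) (@box_compact R n) nat U
  (fun j y => `|G j y - g y| <= t) _ (fun x _ => near_x x).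
move=> /(_ _) Hbox.
(* U contains every tail, so the index can be taken beyond N. *)
have UN : U [set j | (N <= j)%N] by apply: sU; exact: nbhs_infty_ge.
have [j [Hj Nj]] := filter_ex (filterI Hbox UN).
exists j => // x.
apply: (torus_ind (f := fun x => G j x - g x) (P := fun r => `|r| <= t)).
  by move=> i y; rewrite Gp gp.
exact: Hj.
Qed.

(** [half_lap_modulus] makes the approximate solutions equicontinuous. Near their uniform limit g,
    the functions A G_j are close to Psi(x, g(x)), and each Fourier coefficient is continuous for
    the sup norm. *)
Lemma approx_solution_limit (Psi : 'rV[R]_n -> R -> R) (ell B : R) : 0 <= ell ->
  (forall x (y y' : R), `|Psi x y - Psi x y'| <= ell * `|y - y'|) ->
  (forall g, torus_continuous g -> torus_continuous (fun x => Psi x (g x))) ->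
  (forall d, 0 < d -> exists g h, [/\ half_lap g h, forall x, `|g x| <= B &
    forall x, `|h x - Psi x (g x)| <= d]) ->
  exists g, half_lap g (fun x => Psi x (g x)).
Proof.
move=> ell0 Plip Pcont Happ.
have [P0 P00 HP0] := torus_bounded (Pcont _ (@torus_continuous_cst R n 0)).
pose P (j : nat) (p : ('rV[R]_n -> R) * ('rV[R]_n -> R)) :=
  [/\ half_lap p.1 p.2, forall x, `|p.1 x| <= B &
    forall x, `|p.2 x - Psi x (p.1 x)| <= j.+1%:R^-1].
have HP' j : exists p, P j p.
  have [|g [h H]] := Happ j.+1%:R^-1; first by rewrite invr_gt0.
  by exists (g, h).
have [gh Hgh] := choice HP'.
pose G j := (gh j).1; pose H j := (gh j).2.
have HL j : half_lap (G j) (H j) by have [] := Hgh j.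
have GB j x : `|G j x| <= B by have [_ /(_ x)] := Hgh j.
have HP j x : `|H j x - Psi x (G j x)| <= j.+1%:R^-1 by have [_ _ /(_ x)] := Hgh j.
have B0 : 0 <= B by apply: le_trans (GB 0%N 0).
(* A common bound for the A G_j: defect at most 1, |Psi(x, 0)| at most P0, variation of Psi at most
   ell B. *)
pose b := 1 + P0 + ell * B.
have Hb j x : `|H j x| <= b.
  have -> : H j x = (H j x - Psi x (G j x)) + (Psi x (G j x) - Psi x 0) + Psi x 0 by ring.
  apply: le_trans (ler_normD _ _) _.
  have h1 : `|H j x - Psi x (G j x)| <= 1.
    by apply: le_trans (HP j x) _; rewrite invf_le1 // ler1n.
  have h2 : `|Psi x (G j x) - Psi x 0| <= ell * B.
    by apply: le_trans (Plip _ _ _) _; rewrite subr0 ler_wpM2l.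
  have := ler_normD (H j x - Psi x (G j x)) (Psi x (G j x) - Psi x 0).
  by have := HP0 x; rewrite /b; lra.
have b0 : 0 < b by have := mulr_ge0 ell0 B0; rewrite /b; lra.
have GK j k : `|ccoef (G j) k| <= B /\ `|scoef (G j) k| <= B.
  by apply: coef_bound; [have [] := HL j|exact: GB].
have [| |t t0|g gc Hg] := @equicontinuous_ultra_limit G B.
- by move=> j; have [[]] := HL j.
- exact: GB.
(* This choice makes the first term of the modulus t / 2; the radius below makes the second one at
   most t / 2. *)
- have e0 : 0 < t / (2 * b) by rewrite divr_gt0 // mulr_gt0.
  have [C C0 HC] := half_lap_modulus (n := n) e0.
  have CB : 0 <= C * B by rewrite mulr_ge0.
  exists (t / (2 * (C * B + 1))) => [|j x y xy].
    by rewrite divr_gt0 // mulr_gt0 // ltr_wpDl.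
  have [_ /(_ y)] := HC _ _ _ _ (HL j) (Hb j) (GK j) x.
  move=> h; apply: le_trans h _.
  have -> : t / (2 * b) * b = t / 2 by field; rewrite gt_eqF.
  have : C * B * `|x - y| <= t / 2.
    have : (C * B + 1) * `|x - y| <= t / 2.
      rewrite mulrC -ler_pdivlMr ?ltr_wpDl //.
      by apply: le_trans (ltW xy) _; rewrite invfM mulrA.
    by have := normr_ge0 (x - y); lra.
  lra.
have Pc := Pcont g gc.
exists g; split=> //; apply/half_laplacianP => k.
have key t : 0 < t -> exists j, [/\ forall x, `|G j x - g x| <= t &
    forall x, `|H j x - Psi x (g x)| <= (1 + ell) * t].
  (* An index beyond 1 / t also has defect 1 / (j + 1) at most t. *)
  move=> t0; have [j Nj Hj] := Hg t t0 (Num.bound t^-1).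
  exists j; split=> // x.
  have -> : H j x - Psi x (g x) = (H j x - Psi x (G j x)) + (Psi x (G j x) - Psi x (g x)).
    by ring.
  rewrite (le_trans (ler_normD _ _)) // mulrDl mul1r lerD //.
    apply: le_trans (HP j x) _; rewrite invf_ple ?posrE //.
    apply: ltW; apply: lt_le_trans (archi_boundP _) _; first by rewrite invr_ge0 ltW.
    by rewrite ler_nat leqW.
  by apply: le_trans (Plip _ _ _) _; rewrite ler_wpM2l.
have kn := freq_norm_ge0 (R := R) k.
have cK : 0 <= 1 + ell + freq_norm R k by lra.
split; apply/eqP; rewrite -subr_eq0 -normr_le0; apply: (le0_small cK) => t t0.
- have [j [h1 h2]] := key t t0; have [Gc Hc /half_laplacianP/(_ k)[E _]] := HL j.
  have [d1 _] := coef_dist k Gc gc h1; have [d2 _] := coef_dist k Hc Pc h2.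
  have -> : ccoef (fun x => Psi x (g x)) k - freq_norm R k * ccoef g k =
    - (ccoef (H j) k - ccoef (fun x => Psi x (g x)) k) +
    freq_norm R k * (ccoef (G j) k - ccoef g k) by rewrite E; ring.
  rewrite (le_trans (ler_normD _ _)) // normrN normrM (ger0_norm kn) mulrDl.
  by rewrite lerD // ler_wpM2l.
- have [j [h1 h2]] := key t t0; have [Gc Hc /half_laplacianP/(_ k)[_ E]] := HL j.
  have [_ d1] := coef_dist k Gc gc h1; have [_ d2] := coef_dist k Hc Pc h2.
  have -> : scoef (fun x => Psi x (g x)) k - freq_norm R k * scoef g k =
    - (scoef (H j) k - scoef (fun x => Psi x (g x)) k) +
    freq_norm R k * (scoef (G j) k - scoef g k) by rewrite E; ring.
  rewrite (le_trans (ler_normD _ _)) // normrN normrM (ger0_norm kn) mulrDl.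
  by rewrite lerD // ler_wpM2l.
Qed.

(** With a Fejer mean in place of f, the multiplier 1 / (L + |k|) gives an exact solution.
    Contractivity bounds it by M / L, and [approx_solution_limit] removes the truncation. *)
Lemma resolvent_exists (L : R) f : 0 < L -> torus_continuous f ->
  exists g, half_lap g (fun x => f x - L * g x).
Proof.
move=> L0 fc; have [M M0 fM] := torus_bounded fc.
apply: (@approx_solution_limit (fun x (y : R) => f x - L * y) L (M / L)).
- exact: ltW.
- move=> x y y'; have -> : f x - L * y - (f x - L * y') = L * (y' - y) by ring.
  by rewrite normrM gtr0_norm // distrC.
- by move=> g gc; apply: torus_continuousB => //; exact: torus_continuousZ.
- move=> d d0; have [N HN] := fejer_approx fc d0.
  pose g := fejer_mult N (fun k => (L + freq_norm R k)^-1) f.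
  pose h := fejer_mult N (fun k => freq_norm R k * (L + freq_norm R k)^-1) f.
  have gh : half_lap g h by exact: half_lap_fejer_mult.
  have E x : h x = fejer N f x - L * g x.
    apply/eqP; rewrite eq_sym subr_eq eq_sym; apply/eqP.
    rewrite /h /g addrC -fejer_mult_lin fejer_mult1; congr fejer_mult.
    apply/funext => k; rewrite -mulrDl mulfV // gt_eqF //.
    by rewrite ltr_pwDl // freq_norm_ge0.
  exists g, h; split=> // x.
    apply: (half_lap_resolvent_norm gh (e := L^-1)); first by rewrite invr_gt0.
    move=> y; rewrite E mulrBr mulKf ?gt_eqF // addrC subrK.
    rewrite normrM gtr0_norm ?invr_gt0 // mulrC; apply: ler_wpM2r.
      by rewrite invr_ge0 ltW.
    exact: fejer_norm_le.
  rewrite E; have -> : fejer N f x - L * g x - (f x - L * g x) = fejer N f x - f x by ring.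
  exact: HN.
Qed.

End Closure.

(** * Symmetry and positivity of the quadratic form of A *)

Section Energy.
Context {R : realType} {n : nat}.
Implicit Types (f g h u v : 'rV[R]_n -> R) (k l : 'rV[int]_n) (x y z : 'rV[R]_n).

(** A finite Parseval identity. As Fejer means converge uniformly, it transfers relations between
    coefficients to integrals of products. *)
Lemma mean_mul_fejer N f v : torus_continuous f ->
  mean (fun x => f x * fejer N v x) = @fejer_weight R n N *
  \sum_(j : fejer_idx N) \sum_(l : fejer_idx N)
    (fun k => ccoef v k * ccoef f k + scoef v k * scoef f k)
      (fejer_freq j - fejer_freq l).
Proof.
move=> fc.
have Wc k : torus_continuous (fun x => f x * wave (ccoef v k) (scoef v k) k x).
  by apply: torus_continuousM => //; have [] := half_lap_wave (ccoef v k) (scoef v k) k.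
transitivity (@fejer_weight R n N * mean (fun x =>
    \sum_(j : fejer_idx N) \sum_(l : fejer_idx N)
    f x * wave (ccoef v (fejer_freq j - fejer_freq l))
      (scoef v (fejer_freq j - fejer_freq l)) (fejer_freq j - fejer_freq l) x)).
  rewrite -meanZ; last first.
    by apply: torus_continuous_sum => j; apply: torus_continuous_sum => l; exact: Wc.
  congr mean; apply/funext => x; rewrite /fejer mulrCA; congr (_ * _).
  by rewrite mulr_sumr; apply: eq_bigr => j _; rewrite mulr_sumr.
congr (_ * _); rewrite mean_sum => [|j]; last first.
  by apply: torus_continuous_sum => l; exact: Wc.
apply: eq_bigr => j _; rewrite mean_sum => [|l]; last exact: Wc.
apply: eq_bigr => l _; move: (_ - _) => k.
have [c1 c2] := coef_continuous k fc.
rewrite /ccoef /scoef -/(ccoef v k) -/(scoef v k) -(meanZ (scoef v k)) // -mean_lin //.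
  by congr mean; apply/funext => x; rewrite /wave; ring.
exact: torus_continuousZ.
Qed.

Lemma mean_fejer_approx f v (t : R) : torus_continuous f -> torus_continuous v -> 0 < t ->
  exists N0, forall N, (N0 <= N)%N ->
    `|mean (fun x => f x * fejer N v x) - mean (fun x => f x * v x)| <= t.
Proof.
move=> fc vc t0; have [M M0 fM] := torus_bounded fc.
have [|N0 H] := @fejer_approx _ _ v (t / (M + 1)) vc.
  by rewrite divr_gt0 // ltr_wpDl.
exists N0 => N NN; have jc := torus_continuous_fejer N v.
rewrite -meanB; [|exact: torus_continuousM..].
apply: mean_norm_le => [|x]; first by apply: torus_continuousB; exact: torus_continuousM.
rewrite -mulrBr normrM.
have := ler_pM (normr_ge0 _) (normr_ge0 _) (fM x) (H N NN x).
move=> /le_trans; apply; rewrite mulrCA ler_piMr ?ltW //.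
by rewrite ltr_pdivrMr ?ltr_wpDl // mul1r ltrDl.
Qed.

(** After one factor on each side is replaced by its Fejer mean, both sides are the same finite sum,
    with coefficients |k|. *)
Lemma half_lap_sym u h v g : half_lap u h -> half_lap v g ->
  mean (fun x => h x * v x) = mean (fun x => u x * g x).
Proof.
move=> [uc hc /half_laplacianP H] [vc gc /half_laplacianP G].
apply/eqP; rewrite -subr_eq0 -normr_le0; apply: (@le0_small _ _ 2) => // t t0.
have [N1 H1] := mean_fejer_approx hc vc t0.
have [N2 H2] := mean_fejer_approx uc gc t0.
pose N := maxn N1 N2.
have E : mean (fun x => h x * fejer N v x) = mean (fun x => u x * fejer N g x).
  rewrite !mean_mul_fejer //; congr (_ * _); apply: eq_bigr => j _.
  apply: eq_bigr => l _; have [-> ->] := H (fejer_freq j - fejer_freq l).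
  by have [-> ->] := G (fejer_freq j - fejer_freq l); ring.
have {}H1 := H1 N (leq_maxl _ _); have {}H2 := H2 N (leq_maxr _ _).
move: H1 H2; rewrite E !ler_norml => /andP[? ?] /andP[? ?].
by apply/andP; split; lra.
Qed.

Lemma half_lap_pos u h : half_lap u h -> 0 <= mean (fun x => u x * h x).
Proof.
move=> [uc hc /half_laplacianP H].
rewrite -oppr_le0; apply: (@le0_small _ _ 1) => // t t0; rewrite mul1r.
have [N0 H0] := mean_fejer_approx uc hc t0; have {H0} := H0 N0 (leqnn _).
have : 0 <= mean (fun x => u x * fejer N0 h x).
  rewrite mean_mul_fejer // mulr_ge0 ?(ltW (fejer_weight_gt0 _)) //.
  apply: sumr_ge0 => j _; apply: sumr_ge0 => l _.
  have [-> ->] := H (fejer_freq j - fejer_freq l).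
  by apply: addr_ge0; rewrite -mulrA; apply: mulr_ge0;
    rewrite ?freq_norm_ge0 // -expr2 sqr_ge0.
by rewrite ler_norml => ? /andP[]; lra.
Qed.

End Energy.

(** * The signed primitive of a continuous function *)

Section Primitive.
Context {R : realType}.
Variable psi : R -> R.
Hypothesis psi_cont : continuous psi.

Let J (a b : R) := \int[@lebesgue_measure R]_(t in `[a, b]) psi t.

Lemma Rint_chasles a b c : a <= b -> b <= c -> J a c = J a b + J b c.
Proof.
move=> ab bc; apply/eqP; rewrite addrC -subr_eq; apply/eqP.
have I1 := itv_integrable a c psi_cont.
rewrite /J Rintegral_itvB ?bnd_simp //.
apply: Rintegral_itv_obnd_cbnd; apply: integrableS (itv_integrable b c psi_cont) => //.
by apply: subset_itvr; rewrite bnd_simp.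
Qed.

(** An integral over a set has no orientation. A base point below both 0 and y yields the signed
    integral from 0 to y. *)
Definition primitive (y : R) : R := J (- `|y| - 1) y - J (- `|y| - 1) 0.

Lemma primitiveE a y : a <= - `|y| - 1 -> primitive y = J a y - J a 0.
Proof.
move=> ay; have := ler_norm y; have := ler_norm (- y); rewrite normrN => h1 h2.
rewrite (@Rint_chasles a (- `|y| - 1) y) //; last by lra.
rewrite (@Rint_chasles a (- `|y| - 1) 0) //.
by rewrite /primitive; ring.
Qed.

Lemma is_derive_primitive (y : R) : is_derive y (1 : R) primitive (psi y).
Proof.
(* This base point serves all z within distance 1 of y. *)
pose a := - `|y| - 3.
have ay : a < y by have := ler_norm (- y); rewrite normrN /a; lra.
have yu : y < y + 1 by rewrite ltrDl.
have [d1 d2] := continuous_FTC1_closed yu (itv_integrable a (y + 1) psi_cont) ay (psi_cont (x := y)).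
have D : is_derive y (1 : R) (fun z => J a z - J a 0) (psi y).
  have D1 : is_derive y (1 : R) (J a) (psi y).
    by apply: DeriveDef => //; rewrite -derive1E.
  by apply: is_derive_eq; rewrite subr0.
apply: near_eq_is_derive D.
apply/nbhs_ballP; exists 1 => //= z; rewrite -ball_normE /= => yz.
apply/esym/primitiveE; rewrite /a.
have : `|z| <= `|y| + `|y - z| by rewrite -[X in `|X| <= _](subKr y) ler_normB.
lra.
Qed.

Lemma primitive0 : primitive 0 = 0.
Proof. by rewrite /primitive subrr. Qed.

Lemma primitive1 : primitive 1 = \int[@lebesgue_measure R]_(t in `[0, 1[) psi t.
Proof.
rewrite /primitive (@Rint_chasles _ 0 1) //.
rewrite addrC addKr /J; apply/esym/Rintegral_itv_bndo_bndc.
apply: integrableS (itv_integrable 0 1 psi_cont) => //.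
exact: subset_itv_co_cc.
Qed.

End Primitive.

(** * Comparison, implicit steps and intermediate forces *)

Section PeriodicForcing.
Context {R : realType} {n : nat}.
Implicit Types (f g h u v : 'rV[R]_n -> R) (k : 'rV[int]_n) (x : 'rV[R]_n).

Lemma coef_centered_le u (b : R) : 0 <= b -> torus_continuous u ->
  (forall k, k != 0 -> `|ccoef u k| <= b /\ `|scoef u k| <= b) ->
  forall k, `|ccoef (fun x => u x - mean u) k| <= b /\
    `|scoef (fun x => u x - mean u) k| <= b.
Proof.
move=> b0 uc ub k; have c1 := @torus_continuous_cst R n 1.
have WE : (fun x => u x - mean u) = (fun x => - mean u * 1 + u x).
  by apply/funext => x; rewrite mulr1 addrC.
have s1 : scoef (fun _ : 'rV[R]_n => 1) k = 0.
  rewrite -(mean_sin k); congr mean; apply/funext => x; exact: mul1r.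
rewrite WE ccoef_lin // scoef_lin // s1 mulr0 add0r.
have [-> | k0] := eqVneq k 0.
  rewrite !ccoef0 mean_cst mulr1 addNr normr0; split=> //.
  rewrite (_ : scoef u 0 = 0) ?normr0 // -[RHS](@mean_cst R n).
  by congr mean; apply/funext => x; rewrite freq_dot0l sin0 mulr0.
have -> : ccoef (fun _ : 'rV[R]_n => 1) k = 0.
  transitivity (mean (fun x : 'rV[R]_n => cos (freq_dot k x))).
    by congr mean; apply/funext => x; rewrite mul1r.
  by rewrite mean_cos (negPf k0).
by rewrite mulr0 add0r; exact: ub.
Qed.

(** As |k| >= 1 for k != 0, those coefficients of u are bounded by the ones of h, hence by b;
    subtracting the mean removes frequency 0. *)
Lemma half_lap_osc : exists2 C : R, 0 <= C & forall u h b, half_lap u h ->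
  (forall x, `|h x| <= b) -> forall x, `|u x - mean u| <= C * b.
Proof.
have [C C0 HC] := half_lap_modulus (R := R) (n := n) ltr01.
exists (1 + C) => [|u h b H hb x]; first by rewrite addr_ge0.
have Hw := half_lapB H (half_lap_cst (mean u)).
have [uc hc /half_laplacianP uH] := H.
have hb' y : `|h y - 0| <= b by rewrite subr0.
have b0 : 0 <= b := le_trans (normr_ge0 _) (hb 0).
have [|] := HC _ _ b b Hw hb' _ x; last by rewrite mulrDl.
apply: coef_centered_le => // k k0.
have k1 := freq_norm_ge1 (R := R) k0; have [e1 e2] := uH k.
have [] := coef_bound k hc hb.
rewrite e1 e2 !normrM ger0_norm ?freq_norm_ge0 // => b1 b2.
by split; [apply: le_trans b1|apply: le_trans b2]; rewrite ler_peMl.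
Qed.

(** Turns smallness in L^1 or L^2, as seen by the Fourier coefficients, into smallness in the sup
    norm. The two terms of [half_lap_modulus] each receive q / 2. *)
Lemma half_lap_small (H q : R) : 0 <= H -> 0 < q -> exists2 t, 0 < t &
  forall v g, half_lap v g -> (forall x, `|g x| <= H) ->
  (forall k, `|ccoef v k| <= t /\ `|scoef v k| <= t) -> forall x, `|v x| <= q.
Proof.
move=> H0 q0; have e0 : 0 < q / (2 * (H + 1)).
  by rewrite divr_gt0 // mulr_gt0 // ltr_wpDl.
have [C C0 HC] := half_lap_modulus (R := R) (n := n) e0.
exists (q / (2 * (C + 1))) => [|v g vg gH vt x].
  by rewrite divr_gt0 // mulr_gt0 // ltr_wpDl.
have [h _] := HC _ _ _ _ vg gH vt x; apply: le_trans h _.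
have frac (c : R) : 0 <= c -> q / (2 * (c + 1)) * c <= q / 2.
  move=> c0; have c1 : 0 < c + 1 by rewrite ltr_wpDl.
  have -> : q / (2 * (c + 1)) * c = q / 2 * (c / (c + 1)).
    by field; rewrite gt_eqF.
  by rewrite ler_piMr ?divr_ge0 ?(ltW q0) // ler_pdivrMr // mul1r lerDl.
have h1 := frac _ H0; have h2 := frac _ C0; rewrite mulrC in h2.
by lra.
Qed.

Lemma half_lap_comparison (L : R) g h : half_lap g h -> 0 < L ->
  (forall x, 0 <= h x + L * g x) -> forall x, 0 <= g x.
Proof.
move=> H L0 gh; have Li : 0 < L^-1 by rewrite invr_gt0.
apply: (half_lap_resolvent_ge0 H Li) => x.
rewrite -(pmulr_rge0 _ L0) mulrDr mulVKf ?gt_eqF // addrC; exact: gh.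
Qed.

Variables (phi : 'rV[R]_n -> R -> R) (ell M : R).
Hypothesis ell0 : 0 <= ell.
Hypothesis phi_lipx : forall x x' y, `|phi x y - phi x' y| <= ell * `|x - x'|.
Hypothesis phi_lipy : forall x (y y' : R), `|phi x y - phi x y'| <= ell * `|y - y'|.
Hypothesis phi_perx : torus_periodic phi.
Hypothesis phi_pery : forall x y, phi x (y + 1) = phi x y.
Hypothesis phi_bound : forall x y, `|phi x y| <= M.

Lemma phi_bound_ge0 : 0 <= M.
Proof. exact: le_trans (phi_bound 0 0). Qed.

Lemma phi_shift x (y : R) (m : int) : phi x (y + m%:~R) = phi x y.
Proof.
have phin (p : nat) z : phi x (z + p%:R) = phi x z.
  by elim: p => [|p IH]; rewrite ?addr0 // -natr1 addrA phi_pery.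
case: m => p; first exact: phin.
by rewrite NegzE -(phin p.+1) mulrNz subrK.
Qed.

Lemma torus_continuous_phi g : torus_continuous g ->
  torus_continuous (fun x => phi x (g x)).
Proof.
move=> gc; have [gp _] := gc; split=> [i x|].
  by rewrite gp phi_perx.
apply/continuous_epsP => x e e0.
have e1 : 0 < e / (2 * (ell + 1)) by rewrite divr_gt0 // mulr_gt0 // ltr_wpDl.
have [d d0 Hd] := torus_ucont gc e1.
exists (Order.min d (e / (2 * (ell + 1)))) => [|y]; first by rewrite lt_min d0.
rewrite lt_min => /andP[/Hd h1 h2].
have -> : phi x (g x) - phi y (g y) =
  (phi x (g x) - phi y (g x)) + (phi y (g x) - phi y (g y)) by ring.
apply: le_trans (ler_normD _ _) _.
have B (s : R) : s <= e / (2 * (ell + 1)) -> ell * s <= e / 2.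
  rewrite invfM mulrA ler_pdivlMr; last by rewrite ltr_wpDl.
  have [s0|s0] := leP 0 s; first by nra.
  move=> _; apply: (@le_trans _ _ 0); last by lra.
  by rewrite mulr_ge0_le0 // ltW.
have := le_trans (phi_lipx x y (g x)) (B _ (ltW h2)).
have := le_trans (phi_lipy y (g x) (g y)) (B _ h1).
by lra.
Qed.

Lemma stationary_solutionP (F : R) g :
  stationary_solution phi F g <-> half_lap g (fun x => phi x (g x) + F).
Proof.
split=> [[gc [h [hc gh E]]]|[gc hc gh]].
  have <- : h = (fun x => phi x (g x) + F) by apply/funext => x; have := E x; lra.
  by split.
by split=> //; exists (fun x => phi x (g x) + F); split=> // x; lra.
Qed.

Lemma stationary_limit (F B : R) :
  (forall d, 0 < d -> exists g h, [/\ half_lap g h, forall x, `|g x| <= B &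
    forall x, `|h x - (phi x (g x) + F)| <= d]) ->
  exists g, stationary_solution phi F g.
Proof.
move=> H; have [|||g gF] := @approx_solution_limit R n (fun x y => phi x y + F) ell B ell0.
- move=> x y y'; have -> : phi x y + F - (phi x y' + F) = phi x y - phi x y' by ring.
  exact: phi_lipy.
- move=> g gc; apply: torus_continuousD; first exact: torus_continuous_phi.
  exact: torus_continuous_cst.
- exact: H.
by exists g; exact/stationary_solutionP.
Qed.

(** The means may be unbounded. Subtracting their integer parts changes neither A g nor phi(x, g(x))
    and leaves means in [0, 1). *)
Lemma stationary_limit_osc (F W : R) :
  (forall d, 0 < d -> exists g h, [/\ half_lap g h, forall x, `|g x - mean g| <= W &
    forall x, `|h x - (phi x (g x) + F)| <= d]) ->
  exists g, stationary_solution phi F g.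
Proof.
move=> H; apply: (@stationary_limit F (W + 1)) => d /H[g [h [gh gW hd]]].
have /andP[f1 f2] := floor_itv (mean g); move: (Num.floor _) f1 f2 => m f1 f2.
exists (fun x => g x - m%:~R), (fun x => h x - 0); split.
- exact: half_lapB gh (half_lap_cst _).
- move=> x; have -> : g x - m%:~R = (g x - mean g) + (mean g - m%:~R) by ring.
  apply: le_trans (ler_normD _ _) _; rewrite lerD // ger0_norm ?subr_ge0 //.
  by move: f2; rewrite intrD; lra.
- move=> x; have -> : g x - m%:~R = g x + (- m)%:~R by rewrite mulrNz.
  by rewrite phi_shift subr0.
Qed.

(** The resolvent solves (A + L) u' = phi(u) + F + L u. In the form stated, the defect of u' in the
    stationary equation is visibly controlled by |u' - u|. *)
Lemma implicit_step (L F : R) u : 0 < L -> torus_continuous u ->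
  exists u', half_lap u' (fun x => phi x (u x) + F - L * (u' x - u x)).
Proof.
move=> L0 uc; have [|u' H] := @resolvent_exists R n L (fun x => phi x (u x) + F + L * u x) L0.
  apply: torus_continuousD; last exact: torus_continuousZ.
  apply: torus_continuousD; first exact: torus_continuous_phi.
  exact: torus_continuous_cst.
exists u'; move: H; congr half_lap; apply/funext => x; ring.
Qed.

(** From a subsolution u between the ordered solutions, an implicit step leads to a larger
    subsolution u' of the same class. If the mean of u is nearly maximal, u' - u has small mean and
    bounded half-Laplacian, hence is uniformly small. *)
Lemma stationary_interval (F0 F F1 : R) g0 g1 : F0 <= F -> F <= F1 ->
  stationary_solution phi F0 g0 -> stationary_solution phi F1 g1 ->
  exists g, stationary_solution phi F g.
Proof.
move=> F0F FF1 /stationary_solutionP H0 /stationary_solutionP.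
move: g1 => g1' H1'.
have [g0c h0c _] := H0; have [g1'c _ _] := H1'.
have [B0 B00 g0B] := torus_bounded g0c; have [B1 B10 g1B] := torus_bounded g1'c.
(* An integer shift puts the second solution above [g0]; periodicity of phi keeps it a solution. *)
have [m Hm] : exists m : int, B0 + B1 <= m%:~R.
  exists (Num.floor (B0 + B1) + 1); exact/ltW/floorD1_gt.
pose g1 x := g1' x + m%:~R.
have H1 : half_lap g1 (fun x => phi x (g1 x) + F1).
  have := half_lapD H1' (half_lap_cst m%:~R).
  by congr half_lap; apply/funext => x; rewrite addr0 /g1 phi_shift.
have [g1c h1c _] := H1.
have g01 x : g0 x <= g1 x.
  by have := g0B x; have := g1B x; rewrite !ler_norml /g1 => /andP[? ?] /andP[? ?]; lra.
pose B := B0 + B1 + m%:~R + B0.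
have g10B x : g1 x - g0 x <= B.
  by have := g0B x; have := g1B x; rewrite !ler_norml /g1 /B => /andP[? ?] /andP[? ?]; lra.
have Bnn : 0 <= B by apply: le_trans (g10B 0); rewrite subr_ge0.
have M0 := phi_bound_ge0.
pose L := ell + 1; have L0 : 0 < L by rewrite /L ltr_wpDl.
have phi_mono x (y y' : R) : y <= y' -> 0 <= phi x y' - phi x y + ell * (y' - y).
  move=> yy; have := phi_lipy x y' y.
  by rewrite (ger0_norm (x := y' - y)) ?subr_ge0 // ler_norml => /andP[]; lra.
(* Bounds A u for u = [g0] and after every step, where 0 <= L (u' - u) <= L B. *)
pose Hb := M + `|F0| + `|F| + L * B.
have LB : 0 <= L * B by rewrite mulr_ge0 // ltW.
have Hb0 : 0 <= Hb by rewrite /Hb !addr_ge0.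
pose sub u h := [/\ half_lap u h, forall x, g0 x <= u x <= g1 x,
   forall x, h x <= phi x (u x) + F & forall x, `|h x| <= Hb].
pose S := [set r : R | exists u h, sub u h /\ r = mean u].
have S0 : S !=set0.
  exists (mean g0), g0, (fun x => phi x (g0 x) + F0); split=> //; split=> // x.
  - by rewrite lexx g01.
  - by rewrite lerD2l.
  - apply: le_trans (ler_normD _ _) _; rewrite /Hb.
    by have := phi_bound x (g0 x); have := normr_ge0 F; lra.
have Sub : ubound S (mean g1).
  move=> _ [u [h [[[uc _ _] ug _ _] ->]]].
  by apply: mean_le => // x; have /andP[] := ug x.
have Ssup : has_sup S by split=> //; exists (mean g1).
apply: (@stationary_limit F (B + B0)) => d d0.
(* The final defect is at most (L + ell) |u' - u|. *)
have q0 : 0 < d / (L + ell) by rewrite divr_gt0 // ltr_wpDr.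
have [t t0 Ht] := @half_lap_small (Hb + Hb) _ (addr_ge0 Hb0 Hb0) q0.
have [_ [u [h [[uh ug uF hH] ->]]] supu] := sup_adherent t0 Ssup.
have [uc hc _] := uh.
have [u' uh'] := implicit_step F L0 uc.
set h' := (fun x => _) in uh'.
have [uc' hc' _] := uh'.
have vh := half_lapB uh' uh.
(* (A + L)(u' - u) = phi(u) + F - A u, nonnegative for a subsolution u. *)
have uu x : u x <= u' x.
  rewrite -subr_ge0; apply: (half_lap_comparison vh L0) => {}x.
  by have := uF x; rewrite /h'; lra.
(* (A + L)(g1 - u') = phi(g1) - phi(u) + F1 - F + L (g1 - u), nonnegative because L exceeds the
   Lipschitz constant of phi. *)
have ug1 x : u' x <= g1 x.
  rewrite -subr_ge0; apply: (half_lap_comparison (half_lapB H1 uh') L0) => {}x.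
  have /andP[_ ux] := ug x.
  by have := phi_mono x _ _ ux; rewrite /h' /L; lra.
have v0 x : 0 <= u' x - u x by rewrite subr_ge0.
have vB x : u' x - u x <= B.
  by have := g10B x; have := ug1 x; have /andP[] := ug x; lra.
have hH' x : `|h' x| <= Hb.
  rewrite /h'; apply: le_trans (ler_normB _ _) _.
  rewrite (ger0_norm (x := L * _)); last exact: mulr_ge0 (ltW L0) (v0 x).
  have := ler_normD (phi x (u x)) F; have := phi_bound x (u x); have := normr_ge0 F0.
  have : L * (u' x - u x) <= L * B by rewrite ler_pM2l.
  by rewrite /Hb; lra.
have sub' : sub u' h'.
  split=> // x.
    by rewrite ug1 andbT; have /andP[] := ug x; have := uu x; lra.
  by have := phi_mono x _ _ (uu x); rewrite /h' /L; have := v0 x; lra.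
have mv : mean (fun x => u' x - u x) <= t.
  rewrite meanB //; have : mean u' <= sup S.
    by apply: sup_upper_bound => //; exists u', h'.
  by lra.
have vc : torus_continuous (fun x => u' x - u x) by exact: torus_continuousB.
(* As u' - u >= 0, its mean bounds its integral against any c with |c| <= 1, in particular its
   Fourier coefficients. *)
have vbd c : (forall x, `|c x| <= 1) -> torus_continuous c ->
    `|mean (fun x => (u' x - u x) * c x)| <= t.
  move=> c1 cc; have vcc : torus_continuous (fun x => (u' x - u x) * c x).
    exact: torus_continuousM.
  have bd x : `|(u' x - u x) * c x| <= u' x - u x.
    by rewrite normrM ger0_norm // ler_piMr.
  apply: le_trans mv; rewrite ler_norml; apply/andP; split.
    rewrite -meanN //; apply: mean_le => // [|x]; first exact: torus_continuousN.
    by have := bd x; rewrite ler_norml => /andP[].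
  by apply: mean_le => // x; have := bd x; rewrite ler_norml => /andP[].
have vt k : `|ccoef (fun x => u' x - u x) k| <= t /\ `|scoef (fun x => u' x - u x) k| <= t.
  split; apply: vbd => [x|]; rewrite ?cos_max ?sin_max //.
    exact: torus_continuous_cos.
  exact: torus_continuous_sin.
have hh x : `|h' x - h x| <= Hb + Hb.
  by apply: le_trans (ler_normB _ _) _; rewrite lerD.
have vs := Ht _ _ vh hh vt.
exists u', h'; split=> // x.
  have := g0B x; have := g10B x; have /andP[] := ug x; have := uu x; have := ug1 x.
  by rewrite !ler_norml => ? ? ? ? ? /andP[? ?]; apply/andP; split; lra.
rewrite /h'; have -> : phi x (u x) + F - L * (u' x - u x) - (phi x (u' x) + F) =
   - (phi x (u' x) - phi x (u x)) + - (L * (u' x - u x)) by ring.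
apply: le_trans (ler_normD _ _) _; rewrite !normrN normrM (gtr0_norm L0).
have := vs x; rewrite ler_pdivlMr; last by rewrite ltr_wpDr.
by have := phi_lipy x (u' x) (u x); lra.
Qed.

(** A g has mean 0, so F is minus the mean of phi(x, g(x)). *)
Lemma stationary_force_le (F : R) g : stationary_solution phi F g -> F <= M.
Proof.
move=> /stationary_solutionP H; have [gc _ _] := H.
have pc := torus_continuous_phi gc.
have := half_lap_mean H; rewrite meanD //; last exact: torus_continuous_cst.
rewrite mean_cst; have := mean_norm_le pc (fun x => phi_bound x (g x)).
by rewrite ler_norml => /andP[]; lra.
Qed.

End PeriodicForcing.

(** * Energy method for zero force *)

Section ZeroForce.
Context {R : realType} {n : nat}.
Implicit Types (f g h u v : 'rV[R]_n -> R) (k : 'rV[int]_n) (x : 'rV[R]_n).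
Variables (phi : 'rV[R]_n -> R -> R) (ell M : R).
Hypothesis ell0 : 0 <= ell.
Hypothesis phi_lipx : forall x x' y, `|phi x y - phi x' y| <= ell * `|x - x'|.
Hypothesis phi_lipy : forall x (y y' : R), `|phi x y - phi x y'| <= ell * `|y - y'|.
Hypothesis phi_perx : torus_periodic phi.
Hypothesis phi_pery : forall x y, phi x (y + 1) = phi x y.
Hypothesis phi_bound : forall x y, `|phi x y| <= M.

Let Phi x := primitive (phi x).
Let pmean x := Phi x 1.

Lemma phi_continuous x : continuous (phi x).
Proof.
move=> y; apply/cvgrPdist_le => e e0.
have d0 : 0 < e / (ell + 1) by rewrite divr_gt0 // ltr_wpDl.
apply/nbhs_ballP; exists (e / (ell + 1)) => //= z.
rewrite /ball /= ltr_pdivlMr ?ltr_wpDl // => yz.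
apply: le_trans (phi_lipy x y z) _.
by have := normr_ge0 (y - z); lra.
Qed.

Lemma is_derive_Phi x (y : R) : is_derive y (1 : R) (Phi x) (phi x y).
Proof. exact/is_derive_primitive/phi_continuous. Qed.

(** The mean value form of the remainder gives the constant ell. With L = ell + 1, a full square of
    u' - u is left over in the energy estimate. *)
Lemma Phi_taylor x (y y' : R) :
  phi x y * (y' - y) - ell * (y' - y) ^+ 2 <= Phi x y' - Phi x y.
Proof.
have [c cy ->] := mean_value (is_derive_Phi x) y y'.
have h := le_trans (phi_lipy x c y) (ler_wpM2l ell0 cy).
rewrite lerBlDr -lerBlDl -mulrBl (le_trans (ler_norm _)) // normrM distrC.
by rewrite -real_normK ?num_real // expr2 mulrA ler_wpM2r.
Qed.

Lemma Phi_lipy x (y y' : R) : `|Phi x y - Phi x y'| <= M * `|y - y'|.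
Proof.
have [c _ ->] := mean_value (is_derive_Phi x) y' y.
by rewrite normrM ler_wpM2r.
Qed.

Lemma Phi_lipx x x' (y : R) : `|Phi x y - Phi x' y| <= ell * `|x - x'| * `|y|.
Proof.
have D (z : R) : is_derive z (1 : R) (fun t => Phi x t - Phi x' t) (phi x z - phi x' z).
  by have d1 := is_derive_Phi x z; have d2 := is_derive_Phi x' z; exact: is_deriveB.
have [c _] := mean_value D 0 y.
by rewrite /Phi !primitive0 !subr0 => ->; rewrite normrM ler_wpM2r.
Qed.

(** By periodicity of phi, Phi(x, s + 1) - Phi(x, s) has derivative 0 in s; its value at s = 0 is
    [pmean x]. *)
Lemma Phi_shift x (y : R) (m : int) : Phi x (y + m%:~R) = Phi x y + m%:~R * pmean x.
Proof.
have S1 z : Phi x (z + 1) = Phi x z + pmean x.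
  have D (t : R) : is_derive t (1 : R) (fun s => Phi x (s + 1) - Phi x s) 0.
    have d2 := is_derive_Phi x t.
    have d1 : is_derive t (1 : R) (fun s => Phi x (s + 1)) (phi x t).
      have dP := is_derive_Phi x (t + 1).
      have := @is_derive1_comp R (Phi x) (fun s : R => s + 1) t _ 1 dP.
      by rewrite phi_pery mulr1; apply; apply: is_derive_eq; rewrite addr0.
    by have := is_deriveB d1 d2; rewrite subrr.
  have := is_derive_0_is_cst z 0 D.
  by rewrite /= add0r /pmean /Phi primitive0 subr0; lra.
have Sn (p : nat) z : Phi x (z + p%:R) = Phi x z + p%:R * pmean x.
  elim: p => [|p IH]; first by rewrite addr0 mul0r addr0.
  by rewrite -natr1 addrA S1 IH; ring.
case: m => p; first exact: Sn.
have := Sn p.+1 (y + (Negz p)%:~R).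
by rewrite NegzE mulrNz subrK => ->; ring.
Qed.

Lemma pmean_bound x : `|pmean x| <= M.
Proof.
by have := Phi_lipy x 1 0; rewrite /pmean /Phi primitive0 !subr0 normr1 mulr1.
Qed.

(** The difference is 1-periodic in y, so y may be reduced to [0, 1), where each of the two terms is
    at most M. *)
Lemma Phi_linear_bound x (y : R) : `|Phi x y - pmean x * y| <= 2 * M.
Proof.
have M0 := phi_bound_ge0 phi_bound.
have /andP[f1 f2] := floor_itv y; move: (Num.floor y) f1 f2 => m f1 f2.
rewrite intrD in f2.
have := Phi_shift x (y - m%:~R) m; rewrite subrK => ->.
have -> : Phi x (y - m%:~R) + m%:~R * pmean x - pmean x * y =
  Phi x (y - m%:~R) - pmean x * (y - m%:~R) by ring.
set s := y - _; have s1 : `|s| <= 1 by rewrite /s ger0_norm; lra.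
apply: le_trans (ler_normB _ _) _.
have := Phi_lipy x s 0; rewrite /Phi primitive0 !subr0 -/(Phi x) => h1.
have h2 : M * `|s| <= M by rewrite ler_piMr.
have h3 : `|pmean x * s| <= M.
  by rewrite normrM -[leRHS]mulr1 ler_pM // pmean_bound.
lra.
Qed.

Lemma torus_continuous_pmean : torus_continuous pmean.
Proof.
split=> [i x|]; first by rewrite /pmean /Phi phi_perx.
apply/continuous_epsP => x e e0; exists (e / (ell + 1)) => [|y].
  by rewrite divr_gt0 // ltr_wpDl.
rewrite ltr_pdivlMr ?ltr_wpDl // => yz.
apply: le_trans (Phi_lipx x y 1) _; rewrite normr1 mulr1.
by have := normr_ge0 (x - y); lra.
Qed.

Lemma torus_continuous_Phi u : torus_continuous u ->
  torus_continuous (fun x => Phi x (u x)).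
Proof.
move=> uc; have [up _] := uc; have M0 := phi_bound_ge0 phi_bound.
split=> [i x|]; first by rewrite up /Phi phi_perx.
have [U U0 uU] := torus_bounded uc.
apply/continuous_epsP => x e e0.
have eU0 : 0 <= ell * U by rewrite mulr_ge0.
have d10 : 0 < e / (2 * (ell * U + 1)) by rewrite divr_gt0 // mulr_gt0 // ltr_wpDl.
have d20 : 0 < e / (2 * (M + 1)) by rewrite divr_gt0 // mulr_gt0 // ltr_wpDl.
have [d d0 Hd] := torus_ucont uc d20.
exists (Order.min d (e / (2 * (ell * U + 1)))) => [|y]; first by rewrite lt_min d0.
rewrite lt_min => /andP[/Hd h1 h2].
have -> : Phi x (u x) - Phi y (u y) =
  (Phi x (u x) - Phi y (u x)) + (Phi y (u x) - Phi y (u y)) by ring.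
apply: le_trans (ler_normD _ _) _.
have B (c s : R) : 0 <= c -> 0 <= s -> s <= e / (2 * (c + 1)) -> c * s <= e / 2.
  move=> c0 s0; rewrite invfM mulrA ler_pdivlMr; last by rewrite ltr_wpDl.
  by nra.
have h3 : `|Phi x (u x) - Phi y (u x)| <= e / 2.
  apply: le_trans (Phi_lipx _ _ _) _; apply: le_trans (B _ _ eU0 (normr_ge0 _) (ltW h2)).
  by rewrite mulrAC ler_wpM2r // ler_wpM2l.
have h4 := le_trans (Phi_lipy y (u x) (u y)) (B _ _ M0 (normr_ge0 _) h1).
by lra.
Qed.

Lemma torus_argmax_norm u : torus_continuous u ->
  exists x0, forall x, `|u x| <= `|u x0|.
Proof.
move=> [up uc]; have [|x0 Hx0] := @torus_min R n (fun x => - `|u x|).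
  split=> [i x|]; first by rewrite up.
  apply/continuous_epsP => x e e0; have [d d0 Hd] := iffLR (continuous_epsP u) uc x e e0.
  exists d => // y /Hd; apply: le_trans; rewrite -opprD normrN.
  exact: ler_dist_dist.
by exists x0 => x; have := Hx0 x; rewrite lerN2.
Qed.

Hypothesis pmean_mean0 : mean pmean = 0.

Lemma stationary_zero_force : exists g, stationary_solution phi 0 g.
Proof.
have M0 := phi_bound_ge0 phi_bound.
pose L := ell + 1; have L0 : 0 < L by rewrite /L ltr_wpDl.
(* The oscillation s of u' will satisfy s <= D + (s + W) / 4: the factor 1 / (4 L) reduces the
   feedback L (s + W) to a quarter. With D = W / 2 this gives s <= W. *)
have L4 : 0 < (4 * L)^-1 by rewrite invr_gt0 mulr_gt0.
have [C C0 HC] := half_lap_modulus (R := R) (n := n) L4.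
pose D := (4 * L)^-1 * (2 * M) + C * M.
have D0 : 0 <= D by rewrite addr_ge0 // mulr_ge0 // ?mulr_ge0 // ltW.
pose W := 2 * D; have W0 : 0 <= W by rewrite mulr_ge0.
pose H0 := 2 * M + 2 * L * W.
have H00 : 0 <= H0 by rewrite addr_ge0 // !mulr_ge0 // ltW.
(* A class stable under implicit steps, on which the energy is bounded below. The means are left
   free. *)
pose adm u h := [/\ half_lap u h,
  forall k, k != 0 -> `|ccoef u k| <= M /\ `|scoef u k| <= M,
  forall x, `|u x - mean u| <= W & forall x, `|h x| <= H0].
have adm_step u h : adm u h ->
    exists u', adm u' (fun x => phi x (u x) - L * (u' x - u x)).
  move=> [uh uk uW uH]; have [uc hc _] := uh.
  have [u' uh'] := implicit_step ell0 phi_lipx phi_lipy phi_perx 0 L0 uc.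
  have {}uh' : half_lap u' (fun x => phi x (u x) - L * (u' x - u x)).
    by move: uh'; congr half_lap; apply/funext => x; rewrite addr0.
  set h' := (fun x => _) in uh'.
  have [uc' hc' /half_laplacianP hk'] := uh'.
  have pc := torus_continuous_phi ell0 phi_lipx phi_lipy phi_perx uc.
  have vc : torus_continuous (fun x => u' x - u x) by exact: torus_continuousB.
  (* At frequency k, L + |k| times the coefficient of u' is L times that of u plus that of phi(u).
     This is at most L M + M, hence at most (L + |k|) M as |k| >= 1. *)
  have uk' k : k != 0 -> `|ccoef u' k| <= M /\ `|scoef u' k| <= M.
    move=> k0; have [h1 h2] := uk k k0; have [e1 e2] := hk' k.
    have k1 := freq_norm_ge1 (R := R) k0.
    have [p1 p2] := coef_bound k pc (fun x => phi_bound x (u x)).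
    have H'E : h' = (fun x => - L * u' x + (L * u x + phi x (u x))).
      by apply/funext => x; rewrite /h'; ring.
    have lc : torus_continuous (fun x => L * u x + phi x (u x)).
      by apply: torus_continuousD => //; exact: torus_continuousZ.
    rewrite H'E ccoef_lin // ccoef_lin // in e1.
    rewrite H'E scoef_lin // scoef_lin // in e2.
    have gen (q a p : R) : - L * q + (L * a + p) = freq_norm R k * q ->
        `|a| <= M -> `|p| <= M -> `|q| <= M.
      move=> E aM pM; have LK : 0 < L + freq_norm R k by lra.
      have {}E : (L + freq_norm R k) * q = L * a + p by rewrite mulrDl -E; ring.
      rewrite -(ler_pM2l LK) -{1}(gtr0_norm LK) -normrM E.
      apply: le_trans (ler_normD _ _) _; rewrite normrM gtr0_norm // [leRHS]mulrDl.
      apply: lerD; first by rewrite ler_pM2l.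
      by apply: le_trans pM _; rewrite ler_peMl.
    by split; [exact: gen e1 h1 p1|exact: gen e2 h2 p2].
  have wh' := half_lapB uh' (half_lap_cst (mean u')).
  have [wc' _ _] := wh'.
  have [x0 Hx0] := torus_argmax_norm wc'.
  set s := `|_| in Hx0.
  (* A u' has mean 0, so the drift of the mean is governed by phi alone. *)
  have mE : mean (fun x => phi x (u x)) = L * (mean u' - mean u).
    have := half_lap_mean uh'; rewrite /h' meanB //; last exact: torus_continuousZ.
    by rewrite meanZ // meanB //; lra.
  have mM : `|L * (mean u' - mean u)| <= M.
    by rewrite -mE; exact: mean_norm_le.
  have hB' x : `|h' x| <= 2 * M + L * (s + W).
    have -> : h' x = (phi x (u x) - L * (mean u' - mean u)) +
        - (L * ((u' x - mean u') - (u x - mean u))) by rewrite /h'; ring.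
    apply: le_trans (ler_normD _ _) _; rewrite normrN lerD //.
      apply: le_trans (ler_normB _ _) _; have := phi_bound x (u x); lra.
    rewrite normrM gtr0_norm // ler_pM2l //.
    by apply: le_trans (ler_normB _ _) _; rewrite lerD.
  have wk := coef_centered_le M0 uc' uk'.
  have sW : s <= W.
    have hB2 x : `|h' x - 0| <= 2 * M + L * (s + W) by rewrite subr0.
    have [h1 _] := HC _ _ _ _ wh' hB2 wk x0.
    have E : (4 * L)^-1 * (2 * M + L * (s + W)) = (4 * L)^-1 * (2 * M) + (s + W) / 4.
      by field; rewrite gt_eqF.
    by rewrite E -/s in h1; rewrite /W /D; move: h1; rewrite /W /D; lra.
  exists u'; split=> //.
  - by move=> x; exact: le_trans (Hx0 x) sW.
  - move=> x; apply: le_trans (hB' x) _; rewrite /H0 lerD2l.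
    by rewrite (mulrC 2) -mulrA ler_pM2l //; lra.
pose E u h := 2^-1 * mean (fun x => u x * h x) - mean (fun x => Phi x (u x)).
(* The quadratic part is nonnegative, and Phi(x, u) is [pmean x] times u up to 2 M. Since [pmean]
   has mean 0, the linear part only sees u - mean u, bounded by W. *)
have E_bound u h : adm u h -> - (M * W + 2 * M) <= E u h.
  move=> [uh _ uW _]; have [uc hc _] := uh.
  have pc := torus_continuous_pmean; have Pc := torus_continuous_Phi uc.
  have wc : torus_continuous (fun x => u x - mean u).
    by apply: torus_continuousB => //; exact: torus_continuous_cst.
  have h1 := half_lap_pos uh.
  have h2 : `|mean (fun x => Phi x (u x) - pmean x * u x)| <= 2 * M.
    apply: mean_norm_le => [|x]; last exact: Phi_linear_bound.
    by apply: torus_continuousB => //; exact: torus_continuousM.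
  have h3 : `|mean (fun x => pmean x * (u x - mean u))| <= M * W.
    apply: mean_norm_le => [|x]; first exact: torus_continuousM.
    by rewrite normrM ler_pM // pmean_bound.
  have h4 : mean (fun x => pmean x * u x) = mean (fun x => pmean x * (u x - mean u)).
    transitivity (mean (fun x => pmean x * (u x - mean u)) + mean u * mean pmean).
      rewrite -meanZ // -meanD; [|exact: torus_continuousM|exact: torus_continuousZ].
      by congr mean; apply/funext => x; ring.
    by rewrite pmean_mean0 mulr0 addr0.
  rewrite meanB // in h2; last exact: torus_continuousM.
  move: h2 h3; rewrite -h4 !ler_norml => /andP[? ?] /andP[? ?].
  by rewrite /E; lra.
pose S := [set r : R | exists u h, adm u h /\ r = E u h].
have S0 : S !=set0.
  exists (E (fun=> 0) (fun=> 0)), (fun=> 0), (fun=> 0); split=> //; split.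
  - exact: half_lap_cst.
  - move=> k _; have z : `|(0 : R)| <= M by rewrite normr0.
    exact: coef_bound (torus_continuous_cst 0) (fun=> z).
  - by move=> x; rewrite mean_cst subrr normr0.
  - by move=> x; rewrite normr0.
have Sinf : has_inf S.
  split=> //; exists (- (M * W + 2 * M)) => _ [u [h [uh ->]]]; exact: E_bound.
apply: (stationary_limit_osc ell0 phi_lipx phi_lipy phi_perx phi_pery (W := W)).
move=> d d0.
have q0 : 0 < d / (L + ell) by rewrite divr_gt0 // ltr_wpDr.
have [t t0 Ht] := @half_lap_small R n (H0 + H0) _ (addr_ge0 H00 H00) q0.
(* Starting within t^2 of the infimum forces the L^2 norm of u' - u to be at most t. *)
have t20 : 0 < t ^+ 2 by rewrite exprn_gt0.
have [_ [u [h [auh ->]]] infu] := inf_adherent t20 Sinf.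
have [u' auh'] := adm_step _ _ auh.
set h' := (fun x => _) in auh'.
have [uh uk uW uH] := auh; have [uh' uk' uW' uH'] := auh'.
have [uc hc _] := uh; have [uc' hc' _] := uh'.
have vh := half_lapB uh' uh.
pose v x := u' x - u x; pose hv x := h' x - h x.
have vc : torus_continuous v by exact: torus_continuousB.
have hvc : torus_continuous hv by exact: torus_continuousB.
have pc := torus_continuous_phi ell0 phi_lipx phi_lipy phi_perx uc.
have Pc := torus_continuous_Phi uc; have Pc' := torus_continuous_Phi uc'.
have v2c : torus_continuous (fun x => v x ^+ 2).
  by under eq_fun do rewrite expr2; exact: torus_continuousM.
(* With v = u' - u, E(u) - E(u') is the mean of - h' v + v A v / 2 + Phi(x, u') - Phi(x, u). As h' =
   phi(u) - L v, [Phi_taylor] and positivity of A leave at least (L - ell) v^2 in the mean. *)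
have dE : mean (fun x => v x ^+ 2) <= E u h - E u' h'.
  have sym := half_lap_sym uh' vh.
  have pos := half_lap_pos vh.
  (* Expansion of u = u' - v, the cross terms being equal by symmetry of A. *)
  have Q : mean (fun x => u x * h x) = mean (fun x => u' x * h' x) -
      2 * mean (fun x => h' x * v x) + mean (fun x => v x * hv x).
    transitivity (mean (fun x => u' x * h' x) - (mean (fun x => h' x * v x) +
       mean (fun x => u' x * hv x)) + mean (fun x => v x * hv x)); last first.
      by rewrite -[mean (fun x => u' x * hv x)]sym -/v; ring.
    rewrite -meanD; [|exact: torus_continuousM..].
    rewrite -meanB; [|exact: torus_continuousM|]; last first.
      by apply: torus_continuousD; exact: torus_continuousM.
    rewrite -meanD; [|apply: torus_continuousB|exact: torus_continuousM]; last first.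
    - by apply: torus_continuousD; exact: torus_continuousM.
    - exact: torus_continuousM.
    by congr mean; apply/funext => x; rewrite /v /hv; ring.
  have T : mean (fun x => phi x (u x) * v x - ell * v x ^+ 2) <=
      mean (fun x => Phi x (u' x) - Phi x (u x)).
    apply: mean_le => [||x]; last exact: Phi_taylor.
    - by apply: torus_continuousB; [exact: torus_continuousM|exact: torus_continuousZ].
    - exact: torus_continuousB.
  have HV : mean (fun x => h' x * v x) = mean (fun x => phi x (u x) * v x - ell * v x ^+ 2) -
      mean (fun x => v x ^+ 2).
    rewrite -meanB //.
      by congr mean; apply/funext => x; rewrite /h' -/(v x) /L; ring.
    by apply: torus_continuousB; [exact: torus_continuousM|exact: torus_continuousZ].
  rewrite meanB // in T.
  by rewrite /E Q; move: pos T HV; rewrite -/v -/hv; lra.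
have mv2 : mean (fun x => v x ^+ 2) <= t ^+ 2.
  have : inf S <= E u' h' by apply: ge_inf; [case: Sinf|exists u', h'].
  by lra.
have vbd c : (forall x, `|c x| <= 1) -> torus_continuous c ->
    `|mean (fun x => v x * c x)| <= t.
  move=> c1 cc; have vcc : torus_continuous (fun x => v x * c x).
    exact: torus_continuousM.
  (* AM-GM: [|v| <= v^2 / (2 t) + t / 2] *)
  have bd x : `|v x * c x| <= (2 * t)^-1 * v x ^+ 2 + t / 2.
    apply: (@le_trans _ _ `|v x|); first by rewrite normrM ler_piMr.
    have -> : (2 * t)^-1 * v x ^+ 2 + t / 2 = `|v x| + (`|v x| - t) ^+ 2 / (2 * t).
      by rewrite -(real_normK (num_real (v x))); field; rewrite gt_eqF.
    by rewrite lerDl divr_ge0 ?sqr_ge0 // mulr_ge0 // ltW.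
  have bc : torus_continuous (fun x => (2 * t)^-1 * v x ^+ 2 + t / 2).
    by apply: torus_continuousD; [exact: torus_continuousZ|exact: torus_continuous_cst].
  have mb : mean (fun x => (2 * t)^-1 * v x ^+ 2 + t / 2) <= t.
    rewrite mean_lin //; last exact: torus_continuous_cst.
    rewrite mean_cst; have : (2 * t)^-1 * mean (fun x => v x ^+ 2) <= t / 2.
      by rewrite ler_pdivrMl ?mulr_gt0 //; move: mv2; nra.
    by lra.
  apply: le_trans mb; rewrite ler_norml; apply/andP; split.
    rewrite -meanN //; apply: mean_le => // [|x]; first exact: torus_continuousN.
    by have := bd x; rewrite ler_norml => /andP[].
  by apply: mean_le => // x; have := bd x; rewrite ler_norml => /andP[].
have vt k : `|ccoef v k| <= t /\ `|scoef v k| <= t.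
  split; apply: vbd => [x|]; rewrite ?cos_max ?sin_max //.
    exact: torus_continuous_cos.
  exact: torus_continuous_sin.
have hh x : `|h' x - h x| <= H0 + H0.
  by apply: le_trans (ler_normB _ _) _; rewrite lerD.
have vs := Ht _ _ vh hh vt.
exists u', h'; split=> // x.
rewrite /h'; have -> : phi x (u x) - L * (u' x - u x) - (phi x (u' x) + 0) =
   - (phi x (u' x) - phi x (u x)) + - (L * (u' x - u x)) by ring.
apply: le_trans (ler_normD _ _) _; rewrite !normrN normrM (gtr0_norm L0).
have := vs x; rewrite ler_pdivlMr; last by rewrite ltr_wpDr.
by have := phi_lipy x (u' x) (u x); lra.
Qed.

End ZeroForce.

(** * The interval of admissible forces *)

Lemma phi_lipschitz (R : realType) (n : nat) (phi : 'rV[R]_n -> R -> R) :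
  lipschitz (fun p : 'rV[R]_n * R => phi p.1 p.2) -> exists2 ell : R, 0 <= ell &
  (forall x x' y, `|phi x y - phi x' y| <= ell * `|x - x'|) /\
  (forall x y y', `|phi x y - phi x y'| <= ell * `|y - y'|).
Proof.
move=> /pinfty_ex_gt0[ell ell0 H]; exists ell; first exact: ltW.
split=> [x x' y|x y y'].
  have /= := H ((x, y), (x', y)); rewrite prod_normE /= subrr normr0.
  by rewrite max_l //; apply; split.
have /= := H ((x, y), (x, y')); rewrite prod_normE /= subrr normr0.
by rewrite max_r //; apply; split.
Qed.

Theorem theorem3p6 (R : realType) (n : nat) (n_gt0 : (0 < n)%N)
    (phi : 'rV[R]_n -> R -> R)
    (phi_lip : lipschitz (fun p : 'rV[R]_n * R => phi p.1 p.2))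
    (phi_perx : torus_periodic phi)
    (phi_pery : forall x y, phi x (y + 1) = phi x y)
    (phi_mean0 : torus_int (fun x : 'rV[R]_n =>
       \int[@lebesgue_measure R]_(y in `[0, 1[) phi x y) = 0) :
  exists Fstar : R,
    [/\ 0 <= Fstar,
        forall F : R, 0 <= F <= Fstar ->
          exists g : 'rV[R]_n -> R, stationary_solution phi F g
      & forall F : R, Fstar < F ->
          ~ exists g : 'rV[R]_n -> R, stationary_solution phi F g].
Proof.
have [ell ell0 [lipx lipy]] := phi_lipschitz phi_lip.
(* Periodicity reduces y to [0, 1), where phi(x, y) is within ell of phi(x, 0), a continuous
   function on the torus. *)
have [M phiM] : exists M : R, forall x y, `|phi x y| <= M.
  have p0c : torus_continuous (fun x => phi x 0).
    exact: (torus_continuous_phi ell0 lipx lipy phi_perx (torus_continuous_cst 0)).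
  have [M M0 HM] := torus_bounded p0c; exists (M + ell) => x y.
  have /andP[f1 f2] := floor_itv y; move: (Num.floor y) f1 f2 => m f1 f2.
  rewrite intrD in f2.
  have := phi_shift phi_pery x (y - m%:~R) m; rewrite subrK => ->.
  rewrite -(subrK (phi x 0) (phi x _)) addrC.
  apply: le_trans (ler_normD _ _) _; apply: lerD; first exact: HM.
  apply: le_trans (lipy _ _ _) _; rewrite subr0 ler_piMr // ger0_norm; lra.
have pm0 : mean (fun x => primitive (phi x) 1) = 0.
  rewrite /mean (_ : torus_int _ = 0) ?mulr0 // -[RHS]phi_mean0.
  congr torus_int; apply/funext => x; apply: primitive1.
  exact: phi_continuous lipy x.
have zero := stationary_zero_force ell0 lipx lipy phi_perx phi_pery phiM pm0.
pose S := [set F : R | 0 <= F /\ exists g, stationary_solution phi F g].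
have S0 : S 0 by split.
have Sup : has_sup S.
  split; first by exists 0.
  by exists M => F [_ [g Hg]]; exact: (stationary_force_le ell0 lipx lipy phi_perx phiM Hg).
have sup0 : 0 <= sup S by exact: sup_upper_bound.
exists (sup S); split=> //.
- move=> F /andP[F0 FS].
  have [FltS|SF] := ltP F (sup S).
    have SF0 : 0 < sup S - F by rewrite subr_gt0.
    have [F1 [_ [g1 Hg1]] FF1] := sup_adherent SF0 Sup.
    have [g0 Hg0] := zero.
    have FF1' : F <= F1 by move: FF1; rewrite subKr => /ltW.
    exact: (stationary_interval ell0 lipx lipy phi_perx phi_pery phiM F0 FF1' Hg0 Hg1).
  have -> : F = sup S by apply/le_anti; rewrite FS SF.
  (* At the supremum itself, a solution for a slightly smaller F1 is an approximate solution with
     defect sup S - F1. Its half-Laplacian is bounded by M + sup S, which bounds its oscillation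
     uniformly. *)
  have [C C0 HC] := @half_lap_osc R n.
  apply: (stationary_limit_osc ell0 lipx lipy phi_perx phi_pery
    (W := C * (M + sup S))) => d d0.
  have [F1 [F10 [g Hg]] FF1] := sup_adherent d0 Sup.
  have F1S : F1 <= sup S by apply: sup_upper_bound => //; split=> //; exists g.
  have Hg' := iffLR (stationary_solutionP _ _ _) Hg.
  exists g, (fun x => phi x (g x) + F1); split=> // x.
    apply: (HC _ _ _ Hg') => y; apply: le_trans (ler_normD _ _) _.
    by rewrite lerD // ger0_norm.
  have -> : phi x (g x) + F1 - (phi x (g x) + sup S) = - (sup S - F1) by ring.
  by rewrite normrN ger0_norm ?subr_ge0 //; lra.
- move=> F SF [g Hg]; have : F <= sup S.
    apply: sup_upper_bound => //; split; last by exists g.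
    by apply: le_trans sup0 (ltW SF).
  by rewrite leNgt SF.
Qed.
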